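(* Let $\Omega=\bigcup_{i\in I}(\alpha_i,\beta_i)\subset\mathbb{R}$ be a finite or countable union of disjoint, possibly unbounded intervals, and assume that $l=\inf_{i\in I}(\beta_i-\alpha_i)>0$. Suppose $H$ is a self-adjoint extension of the differential operator $D=\frac{1}{2\pi i}\frac{d}{dx}$ on $C_0^\infty(\Omega)$ and let $\{U(t)\}_{t\in\mathbb{R}}$, $U(t)=\exp(2\pi i tH)$, be the associated unitary group with the integrability property. Let $(\mu,m,C)$ be spectral data for $H$ and let $B=(b_{i,k})$ be the boundary matrix of $\{U(t)\}$. Then $$C^{\mathrm{f}\beta}(\lambda)\,\operatorname{Exp}(-\lambda\vec\beta)\,B^T\,\operatorname{Exp}(\lambda\vec\alpha)=C^{\mathrm{f}\alpha}(\lambda)\qquad\text{for }\mu\text{-a.e. }\lambda.$$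
   Context: $C_0^\infty(\Omega)$ is the space of $C^\infty$ compactly supported functions on $\Omega$, and $\hat f(\lambda)=\int_{\mathbb{R}}f(x)e^{-2\pi i\lambda x}dx$. The components of $\Omega$ are the intervals $(\alpha_i,\beta_i)$, indexed by $I$; $p(\Omega)$ is the cardinality of $I$, possibly infinite. For a function $\varphi$ on $\Omega$, $\varphi_i$ equals $\varphi$ on $(\alpha_i,\beta_i)$ and $0$ elsewhere, and $F\varphi(\lambda)=(\hat\varphi_i(\lambda))_{i\in I}$. $l^2(m)$ is $\{0\}$, $\mathbb{C}^m$, or $l^2(\mathbb{N})$ according to $m=0$, $0<m<\infty$, $m=\infty$. A multiplicity function is a Borel measurable $m:\mathbb{R}\to\mathbb{N}\cup\{0,\infty\}$; $L^2(\mu,m)$ is the direct integral of the spaces $l^2(m(\lambda))$ with respect to $\mu$. Spectral data for a self-adjoint extension $H$ of $D$: a triple $(\mu,m,C)$ consisting of a positive Radon measure $\mu$ on $\mathbb{R}$, a multiplicity function $m$, and a measurable field $C$ of complex matrices $C(\lambda)$ of dimension $m(\lambda)\times p(\Omega)$ (columns indexed by $I$), such that $\mathcal{F}_C:C_0^\infty(\Omega)\to L^2(\mu,m)$, $\mathcal{F}_C\varphi(\lambda)=C(\lambda)F\varphi(\lambda)$, extends to an isometric isomorphism from $L^2(\Omega)$ to $L^2(\mu,m)$ with $H=\mathcal{F}_C^{-1}M_\lambda\mathcal{F}_C$, where $M_\lambda$ is multiplication by $\lambda$ with domain $\{\varphi\in L^2(\mu,m):\lambda\varphi\in L^2(\mu,m)\}$.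 Such data exist for every self-adjoint extension $H$ of $D$. Integrability property of a strongly continuous unitary group $\{U(t)\}_{t\in\mathbb{R}}$ on $L^2(\Omega)$: for every $x\in\Omega$, all neighborhoods $V$ of $x$ in $\Omega$ and all $\epsilon>0$ such that $V+t\subset\Omega$ for all $t\in\mathbb{R}$ with $|t|<\epsilon$, one has $(U(t)f)(y)=f(y+t)$ for all $y\in V$, all $|t|<\epsilon$ and all $f\in L^2(\Omega)$. The group $U(t)=\exp(2\pi itH)$ has this property. Boundary matrix of $\{U(t)\}$: the unitary matrix $B=(b_{i,k})_{i,k\in I,\ \alpha_i>-\infty,\ \beta_k<\infty}$ (rows indexed by $i$ with $\alpha_i>-\infty$, columns by $k$ with $\beta_k<\infty$) such that for all $0<\epsilon<l$: (a) if $\alpha_i>-\infty$ and $f\in L^2(\Omega)$ is supported on $[\alpha_i,\alpha_i+\epsilon]$, then $U(\epsilon)f$ is supported on $\bigcup_{k,\beta_k<\infty}[\beta_k-\epsilon,\beta_k]$ and $U(\epsilon)f=\sum_{k,\ \beta_k<\infty}b_{i,k}T(\alpha_i+\epsilon-\beta_k)f$; (b) if $\beta_k<\infty$ and $f\in L^2(\Omega)$ is supported on $[\beta_k-\epsilon,\beta_k]$, then $U(-\epsilon)f$ is supported on $\bigcup_{j,\alpha_j>-\infty}[\alpha_j,\alpha_j+\epsilon]$ and $U(-\epsilon)f=\sum_{j,\ \alpha_j>-\infty}\overline{b_{j,k}}\,T(\beta_k-\alpha_j-\epsilon)f$. Here $T(t)f(x)=f(x+t)$, with $f$ regarded as $0$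 outside $\Omega$. Such a matrix exists for every unitary group with the integrability property when $l>0$. $C^{\mathrm{f}\alpha}(\lambda)$ is the matrix obtained from $C(\lambda)$ by removing the column corresponding to the component with $\alpha_i=-\infty$ (if any); $C^{\mathrm{f}\beta}(\lambda)$ is obtained from $C(\lambda)$ by removing the column corresponding to the component with $\beta_k=\infty$ (if any). $\operatorname{Exp}(\lambda\vec\alpha)$ is the diagonal matrix with entries $(e^{2\pi i\lambda\alpha_i})_{i\in I,\alpha_i>-\infty}$, and $\operatorname{Exp}(\lambda\vec\beta)$ is the diagonal matrix with entries $(e^{2\pi i\lambda\beta_k})_{k\in I,\beta_k<\infty}$ (in the exponents, the $i$ multiplying $2\pi$ is the imaginary unit). $B^T$ is the transpose of $B$.
   Formalization: For infinitely many intervals the series in the matrix product may fail to converge unconditionally at a.e. λ; there the identity is read as convergence of its columns in L² of (μ,m) on compact sets, with equality of entries for μ-a.e. λ wherever the sum exists. *)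

(* Defs.v *)
From mathcomp Require Import all_boot all_order all_algebra.
From mathcomp Require Import finmap.
From mathcomp Require Import all_classical all_reals all_analysis.
From mathcomp Require Import summability.
From mathcomp Require Import complex.

Set Implicit Arguments.
Unset Strict Implicit.
Unset Printing Implicit Defensive.

Import Order.TTheory GRing.Theory Num.Theory.
Import numFieldNormedType.Exports.

Local Open Scope classical_set_scope.
Local Open Scope complex_scope.
Local Open Scope ring_scope.

Section Complex_preliminaries.
Context {R : realType}.

Definition expi (x : R) : R[i] := cos (2 * pi * x) +i* sin (2 * pi * x).

Definition two_pi_i : R[i] := 0 +i* (2 * pi).

Definition sqnormc (z : R[i]) : R := complex.Re z ^+ 2 + complex.Im z ^+ 2.

(* Unordered summation: the net of the finite partial sums converges. When the
   index type is finite the net is eventually constant, and [has_sum u s] says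
   that [s] is the finite sum. *)
Definition has_sum (K : choiceType) (u : K -> R[i]) (s : R[i]) : Prop :=
  sqnormc (partial_sum u F - s) @[F --> totally] --> (0 : R).

Definition cmeasurable (D : set R) (f : R -> R[i]) : Prop :=
  measurable_fun D (fun x => complex.Re (f x)) /\
  measurable_fun D (fun x => complex.Im (f x)).

Definition cintegral (f : R -> R[i]) : R[i] :=
  (\int[lebesgue_measure]_x complex.Re (f x)) +i*
  (\int[lebesgue_measure]_x complex.Im (f x)).

Definition fourier (f : R -> R[i]) (lam : R) : R[i] :=
  cintegral (fun x => f x * expi (- (lam * x))).

Definition csmooth (f : R -> R[i]) : Prop :=
  forall (n : nat) (x : R),
    derivable (derive1n n (fun y => complex.Re (f y))) x 1 /\
    derivable (derive1n n (fun y => complex.Im (f y))) x 1.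

Definition cderive (f : R -> R[i]) (x : R) : R[i] :=
  derive1 (fun y => complex.Re (f y)) x +i* derive1 (fun y => complex.Im (f y)) x.

Definition translate (t : R) (f : R -> R[i]) : R -> R[i] := fun x => f (x + t).

End Complex_preliminaries.

Section Open_set.
Context {R : realType} {I : countType}.
Implicit Types alpha beta : I -> \bar R.

Definition component alpha beta (i : I) : set R :=
  [set x : R | (alpha i < x%:E)%E /\ (x%:E < beta i)%E].

Definition Omega alpha beta : set R := \bigcup_i component alpha beta i.

Definition min_length alpha beta : \bar R :=
  ereal_inf [set (beta i - alpha i)%E | i in [set: I]].

(* Indices of the components whose left (right) endpoint is finite; removing a
   column of a matrix is restricting its column index to one of these types. *)
Definition fin_left alpha : countType := {i : I | (-oo < alpha i)%E}.
Definition fin_right beta : countType := {k : I | (beta k < +oo)%E}.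

Definition left_end alpha (i : fin_left alpha) : R := fine (alpha (val i)).
Definition right_end beta (k : fin_right beta) : R := fine (beta (val k)).

Definition cut alpha beta (phi : R -> R[i]) (i : I) : R -> R[i] :=
  fun x => if x \in component alpha beta i then phi x else 0.

End Open_set.

(* Elements of L^2(Om) are represented by measurable functions on the whole
   line that vanish outside Om, and are identified when they agree Lebesgue
   almost everywhere. Unbounded operators are given by their graphs, which are
   closed under this identification. *)

Section L2.
Context {R : realType}.
Implicit Types (Om : set R) (f g h : R -> R[i]).
Implicit Type H : (R -> R[i]) -> (R -> R[i]) -> Prop.
Implicit Type U : R -> (R -> R[i]) -> R -> R[i].

Definition sqnorm f : \bar R :=
  (\int[lebesgue_measure]_x (sqnormc (f x))%:E)%E.

Definition in_L2 Om f : Prop :=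
  [/\ cmeasurable setT f, forall x, ~ Om x -> f x = 0 & (sqnorm f < +oo)%E].

Definition eq_ae f g : Prop := {ae lebesgue_measure, forall x, f x = g x}.

Definition supported_on (S : set R) f : Prop :=
  {ae lebesgue_measure, forall x, ~ S x -> f x = 0}.

Definition inner f g : R[i] := cintegral (fun x => f x * (g x)^*).

Definition has_L2_sum (K : choiceType) (u : K -> R -> R[i]) f : Prop :=
  sqnorm (fun x => partial_sum (fun k => u k x) F - f x)
    @[F --> totally] --> 0%E.

Definition test_function Om (phi : R -> R[i]) : Prop :=
  csmooth phi /\
  exists K : set R, [/\ compact K, K `<=` Om & forall x, ~ K x -> phi x = 0].

Record linear_operator Om H : Prop := LinearOperator {
  op_L2 : forall f g, H f g -> in_L2 Om f /\ in_L2 Om g ;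
  op_eq_ae : forall f g f' g', H f g -> in_L2 Om f' -> in_L2 Om g' ->
    eq_ae f f' -> eq_ae g g' -> H f' g' ;
  op_functional : forall f g g', H f g -> H f g' -> eq_ae g g' ;
  op_linear : forall (a : R[i]) f g f' g', H f g -> H f' g' ->
    H (fun x => a * f x + f' x) (fun x => a * g x + g' x)
}.

Definition densely_defined Om H : Prop :=
  forall f (e : R), in_L2 Om f -> 0 < e ->
    exists f1 g1, H f1 g1 /\ (sqnorm (fun x => (f x - f1 x)%R) < e%:E)%E.

Definition adjoint Om H g h : Prop :=
  [/\ in_L2 Om g, in_L2 Om h &
      forall f f', H f f' -> inner f' g = inner f h].

Definition self_adjoint Om H : Prop :=
  [/\ linear_operator Om H, densely_defined Om H &
      forall g h, H g h <-> adjoint Om H g h].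

Definition extends_D Om H : Prop :=
  forall phi, test_function Om phi ->
    H phi (fun x => two_pi_i^-1 * cderive phi x).

(* The group law gives the bijectivity of each U t. *)
Record unitary_group Om U : Prop := UnitaryGroup {
  ugrp_L2 : forall t f, in_L2 Om f -> in_L2 Om (U t f) ;
  ugrp_eq_ae : forall t f g, in_L2 Om f -> in_L2 Om g ->
    eq_ae f g -> eq_ae (U t f) (U t g) ;
  ugrp_linear : forall t (a : R[i]) f g, in_L2 Om f -> in_L2 Om g ->
    eq_ae (U t (fun x => a * f x + g x)) (fun x => a * U t f x + U t g x) ;
  ugrp_inner : forall t f g, in_L2 Om f -> in_L2 Om g ->
    inner (U t f) (U t g) = inner f g ;
  ugrp_zero : forall f, in_L2 Om f -> eq_ae (U 0 f) f ;
  ugrp_add : forall s t f, in_L2 Om f -> eq_ae (U (s + t) f) (U s (U t f)) ;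
  ugrp_continuous : forall s f, in_L2 Om f ->
    sqnorm (fun x => U t f x - U s f x) @[t --> s] --> 0%E
}.

(* U t = exp (2 pi i t H): U is the strongly continuous unitary group that
   Stone's theorem associates with the self-adjoint operator H, that is, the
   one whose infinitesimal generator is 2 pi i H, with equality of domains. *)
Definition is_exp_group Om H U : Prop :=
  unitary_group Om U /\
  forall f g, H f g <->
    [/\ in_L2 Om f, in_L2 Om g &
        sqnorm (fun x => (t^-1)%:C * (U t f x - f x) - two_pi_i * g x)
          @[t --> (0 : R)^'] --> 0%E].

Definition integrability_property Om U : Prop :=
  forall (x : R) (V : set R) (e : R),
    Om x -> nbhs x V -> V `<=` Om -> 0 < e ->
    (forall t y : R, `|t| < e -> V y -> Om (y + t)) ->
    forall (t : R) f, `|t| < e -> in_L2 Om f ->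
      {ae lebesgue_measure, forall y : R, V y -> U t f y = f (y + t)}.

End L2.

Section Boundary.
Context {R : realType} {I : countType}.

Record boundary_matrix (alpha beta : I -> \bar R)
    (U : R -> (R -> R[i]) -> R -> R[i])
    (B : fin_left alpha -> fin_right beta -> R[i]) : Prop := BoundaryMatrix {
  bdry_rows : forall i j,
    has_sum (fun k => B i k * (B j k)^*) (i == j)%:R ;
  bdry_cols : forall k l,
    has_sum (fun i => (B i k)^* * B i l) (k == l)%:R ;
  bdry_forward : forall (e : R) (i : fin_left alpha) (f : R -> R[i]),
    0 < e -> (e%:E < min_length alpha beta)%E ->
    in_L2 (Omega alpha beta) f ->
    supported_on `[left_end i, left_end i + e]%classic f ->
    supported_on
      (\bigcup_(k : fin_right beta) `[right_end k - e, right_end k]%classic)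
      (U e f) /\
    has_L2_sum
      (fun (k : fin_right beta) x =>
        B i k * translate (left_end i + e - right_end k) f x)
      (U e f) ;
  bdry_backward : forall (e : R) (k : fin_right beta) (f : R -> R[i]),
    0 < e -> (e%:E < min_length alpha beta)%E ->
    in_L2 (Omega alpha beta) f ->
    supported_on `[right_end k - e, right_end k]%classic f ->
    supported_on
      (\bigcup_(j : fin_left alpha) `[left_end j, left_end j + e]%classic)
      (U (- e) f) /\
    has_L2_sum
      (fun (j : fin_left alpha) x =>
        (B j k)^* * translate (right_end k - left_end j - e) f x)
      (U (- e) f)
}.

(* The matrix Exp(- lam beta) B^T Exp(lam alpha), written entrywise since the
   two outer factors are diagonal *)
Definition ExpBTExp (alpha beta : I -> \bar R)
    (B : fin_left alpha -> fin_right beta -> R[i]) (lam : R)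
    (k : fin_right beta) (i : fin_left alpha) : R[i] :=
  expi (- (lam * right_end k)) * B i k * expi (lam * left_end i).

End Boundary.

Section Spectral.
Context {R : realType}.

Definition radon (mu : {measure set (measurableTypeR R) -> \bar R}) : Prop :=
  (forall K : set R, compact K -> (mu K < +oo)%E) /\
  (forall A : set (measurableTypeR R), measurable A ->
    mu A = ereal_sup [set mu K | K in
      [set K : set R | compact K /\ K `<=` A]]).

(* Multiplicities: [None] stands for infinity. [below n m] says that [n] is a
   coordinate of l^2(m). *)
Definition below (n : nat) (m : option nat) : bool :=
  if m is Some k then (n < k)%N else true.

Definition multiplicity_function (m : R -> option nat) : Prop :=
  forall c : option nat, measurable [set lam : R | m lam = c].

(* A section of the direct integral of the l^2(m lam) is a function
   g : R -> nat -> C whose value at lam is carried by the coordinates below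
   m lam. *)
Definition fiber_sqnorm (m : R -> option nat) (g : R -> nat -> R[i])
    (lam : R) : \bar R :=
  (\sum_(0 <= n <oo | below n (m lam)) (sqnormc (g lam n))%:E)%E.

Section Direct_integral.
Variables (mu : {measure set (measurableTypeR R) -> \bar R}).
Variables (m : R -> option nat).
Implicit Types g h : R -> nat -> R[i].

Definition in_L2mu g : Prop :=
  [/\ forall n, cmeasurable setT (fun lam => g lam n),
      forall lam n, ~~ below n (m lam) -> g lam n = 0 &
      (\int[mu]_lam fiber_sqnorm m g lam < +oo)%E].

Definition eq_mu g h : Prop := {ae mu, forall lam, forall n, g lam n = h lam n}.

Record isometric_iso (Om : set R) (W : (R -> R[i]) -> R -> nat -> R[i])
    : Prop := IsometricIso {
  iso_L2 : forall f, in_L2 Om f -> in_L2mu (W f) ;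
  iso_eq_ae : forall f f', in_L2 Om f -> in_L2 Om f' ->
    eq_ae f f' -> eq_mu (W f) (W f') ;
  iso_linear : forall (a : R[i]) f f', in_L2 Om f -> in_L2 Om f' ->
    eq_mu (W (fun x => a * f x + f' x))
          (fun lam n => a * W f lam n + W f' lam n) ;
  iso_norm : forall f, in_L2 Om f ->
    (\int[mu]_lam fiber_sqnorm m (W f) lam = sqnorm f)%E ;
  iso_onto : forall g, in_L2mu g -> exists2 f, in_L2 Om f & eq_mu (W f) g
}.

(* The matrix C(lam) has entries C lam n i for n below m lam; the values of
   C lam n i for the other n are irrelevant. *)
Definition measurable_field (I : countType) (C : R -> nat -> I -> R[i]) : Prop :=
  forall n i, cmeasurable [set lam | below n (m lam)] (fun lam => C lam n i).

(* For a test function phi only finitely many of the functions phi_i are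
   nonzero, so the sum has finite support. *)
Definition F_C (I : countType) (alpha beta : I -> \bar R)
    (C : R -> nat -> I -> R[i]) (phi : R -> R[i]) : R -> nat -> R[i] :=
  fun lam n => if below n (m lam) then
    \sum_(i \in [set: I]) C lam n i * fourier (cut alpha beta phi i) lam
  else 0.

(* A(lam) X(lam) = P(lam) for mu-almost every lam, for a field A of matrices of
   dimension m(lam) x K, and fields X, P of dimensions K x L, m(lam) x L.
   When K is finite, each of the two clauses says exactly that
   the entries of P(lam) are the finite sums \sum_k A(lam)_{n,k} X(lam)_{k,i},
   for mu-almost every lam. When K is infinite the rows of A(lam)
   need not be square summable and the series defining the product need not
   converge pointwise; the first clause then takes the sum of the columns
   A(lam)_{.,k} X(lam)_{k,i} in the direct integral, locally in lam, and
   the second one takes it pointwise, whenever it makes sense. *)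
Definition mulmx_ae (K L : countType) (A : R -> nat -> K -> R[i])
    (X : R -> K -> L -> R[i]) (P : R -> nat -> L -> R[i]) : Prop :=
  (forall (i : L) (S : set R), compact S ->
    (\int[mu]_(lam in S) fiber_sqnorm m
       (fun lam' n => (partial_sum (fun k => A lam' n k * X lam' k i) F
                       - P lam' n i)%R) lam)%E
      @[F --> totally] --> 0%E) /\
  {ae mu, forall lam, forall (n : nat) (i : L) (s : R[i]), below n (m lam) ->
    has_sum (fun k => A lam n k * X lam k i) s -> s = P lam n i}.

End Direct_integral.

Definition spectral_data (I : countType) (alpha beta : I -> \bar R)
    (H : (R -> R[i]) -> (R -> R[i]) -> Prop)
    (mu : {measure set (measurableTypeR R) -> \bar R}) (m : R -> option nat)
    (C : R -> nat -> I -> R[i]) : Prop :=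
  [/\ radon mu, multiplicity_function m, measurable_field m C &
      exists W : (R -> R[i]) -> R -> nat -> R[i],
        [/\ isometric_iso mu m (Omega alpha beta) W,
            forall phi, test_function (Omega alpha beta) phi ->
              eq_mu mu (W phi) (F_C m alpha beta C phi) &
            forall f g, H f g <->
              [/\ in_L2 (Omega alpha beta) f, in_L2 (Omega alpha beta) g,
                  in_L2mu mu m (fun lam n => lam%:C * W f lam n) &
                  eq_mu mu (W g) (fun lam n => lam%:C * W f lam n)]]].

End Spectral.

Definition C_falpha (R : realType) (I : countType) (alpha : I -> \bar R)
    (C : R -> nat -> I -> R[i]) (lam : R) (n : nat) (i : fin_left alpha) :
    R[i] := C lam n (val i).

Definition C_fbeta (R : realType) (I : countType) (beta : I -> \bar R)
    (C : R -> nat -> I -> R[i]) (lam : R) (n : nat) (k : fin_right beta) :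
    R[i] := C lam n (val k).

(* Main.v *)
Require Import Defs.
From mathcomp Require Import all_boot all_order all_algebra.
From mathcomp Require Import finmap.
From mathcomp Require Import all_classical all_reals all_analysis.
From mathcomp Require Import summability measurable_realfun.
From mathcomp Require Import complex.
From mathcomp Require Import ring lra.

Set Implicit Arguments.
Unset Strict Implicit.
Unset Printing Implicit Defensive.

Import Order.TTheory GRing.Theory Num.Theory.
Import numFieldNormedType.Exports.

Local Open Scope classical_set_scope.
Local Open Scope complex_scope.
Local Open Scope ring_scope.

(** Let [W] be the unitary map of the spectral data. Two facts make it explicit
    on a smooth function [phi] supported in a single component [i]: [W phi] is
    the column [C(lam)_i] times the Fourier transform of [phi], and [U t] becomes
    multiplication by [expi (lam * t)].

    Let [phi] be a narrow bump centred at [left_end i + e / 2]. During the time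
    [e] it is carried to the left, leaves the component through its left end and
    reenters through right ends: by the boundary matrix, [U e phi] is the sum over
    [k] of [B i k] times the same bump centred at [right_end k - e / 2]. Every
    bump is a translate of the one centred at 0, whose transform is called [Psi],
    so that applying [W] to this sum gives
      expi (lam e) C_i expi (- lam (left_end i + e / 2)) Psi
        = \sum_k B_ik C_k expi (- lam (right_end k - e / 2)) Psi,
    and the relation follows on dividing by [Psi] and by a phase. The division
    is harmless: on a bounded window of frequencies [Psi] is bounded away from 0
    as soon as the bump is narrow enough ([fourier_bump_lb]). The sum over [k]
    converges in L^2, hence, [W] being isometric, its image converges in the
    direct integral over the window. This is [defect_column_cvg0], which is the
    first half of the conclusion since every compact set lies in a window.

    For the second half, norm convergence along an increasing exhaustion of
    the index set by finite sets forces the liminf of the fibre norms to vanish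
    almost everywhere, so that a pointwise sum, when it exists, can only be the
    entry of [C] ([limit_ae_unique]).

    That [U t] becomes a multiplication operator ([iso_evolution]) is derived
    from the definition of the generator, without functional calculus. Cut the
    time [t] into [K] steps of length [s]. In each step the first-order Taylor
    error of [U s] has the same norm, because [U] commutes with its generator,
    and this norm is o(s); on a window the multiplier [expi (lam * s)] has an
    error of order s^2. Summing [K] errors in quadratic mean multiplies the
    square by at most [K ^ 2], and K^2 o(s^2) tends to 0. *)

(** * A smooth bump with compact support *)

Section Flat.
Context {R : realType}.
Implicit Types (a b c x : R) (n m : nat).

(** The derivatives of exp(-1/x) extended by 0 are combinations of
    exp(-1/x) x^-n; the exponent [n] keeps the family closed under derivation. *)
Definition flat n x : R := if 0 < x then expR (- x^-1) * x^-1 ^+ n else 0.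

Lemma flat_ge0 n x : 0 <= flat n x.
Proof.
rewrite /flat; case: ifP => // x0.
by rewrite mulr_ge0 ?expR_ge0// exprn_ge0// invr_ge0 ltW.
Qed.

Lemma flat_le0 n x : x <= 0 -> flat n x = 0.
Proof. by rewrite /flat ltNge => ->. Qed.

(** Keeping the single term of degree [n + 2] of the series of exp(1/x) shows
    that exp(-1/x) beats every power of 1/x; order 2 is what differentiability at
    0 asks for. *)
Lemma flat_quadratic n x : `|flat n x| <= (n.+2)`!%:R * x ^+ 2.
Proof.
rewrite ger0_norm ?flat_ge0//; rewrite /flat; case: ifPn => [x0|_]; last first.
  by rewrite mulr_ge0 ?ler0n ?sqr_ge0.
have y0 : 0 < x^-1 by rewrite invr_gt0.
have := @expR_ge1Dxn R x^-1 n.+1 (ltW y0).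
rewrite -(ler_pM2l (expR_gt0 (- x^-1))) -expRD addNr expR0.
set e := expR _ => he.
have {he} : e * (x^-1 ^+ n.+2 / (n.+2)`!%:R) <= 1.
  by apply: le_trans he; rewrite ler_pM2l ?expR_gt0// lerDr.
have f0 : 0 < (n.+2)`!%:R :> R by rewrite ltr0n fact_gt0.
rewrite mulrA ler_pdivrMr// mul1r => h.
have -> : e * x^-1 ^+ n = e * x^-1 ^+ n.+2 * x ^+ 2.
  rewrite -[n.+2]addn2 exprD -mulrA -mulrA -exprMn mulVf ?gt_eqF//.
  by rewrite expr1n mulr1.
by rewrite ler_pM2r// exprn_gt0.
Qed.

Lemma is_derive_quadratic (f : R -> R) (K : R) :
  (forall x, `|f x| <= K * x ^+ 2) -> is_derive (0 : R) (1 : R) f (0 : R).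
Proof.
move=> fK.
have f0 : f 0 = 0.
  by apply/eqP; rewrite -normr_le0 (le_trans (fK _))// expr0n mulr0.
have cv : (fun h : R => h^-1 *: (f (h *: (1 : R) + 0) - f 0)) @ 0^' --> (0 : R).
  apply/cvgr0Pnorm_le => e e0.
  have K1 : 0 < K + 1.
    have := le_trans (normr_ge0 _) (fK 1); rewrite expr1n mulr1 => K0.
    by rewrite ltr_wpDl.
  have d0 : 0 < e / (K + 1) by rewrite divr_gt0.
  near=> h.
  have h0 : h != 0 by near: h; exact: nbhs_dnbhs_neq.
  rewrite f0 subr0 addr0 [h *: 1]mulr1 normrZ normfV ler_pdivrMl ?normr_gt0//.
  apply: (le_trans (fK h)).
  rewrite -[h ^+ 2]ger0_norm ?sqr_ge0// normrX expr2.
  have hd : `|h| <= e / (K + 1).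
    by near: h; apply: dnbhs0_le.
  rewrite mulrCA ler_pM2l ?normr_gt0//.
  have := hd; rewrite ler_pdivlMr// => hd'.
  apply: le_trans hd'; rewrite mulrDr mulrC mulr1 lerDl//.
split; first by apply/cvg_ex; exists 0.
by apply: cvg_lim.
Unshelve. all: by end_near. Qed.

(** Only the point 0 is delicate: there the quadratic bound makes the derivative
    0, which is also the value of the right-hand side. *)
Lemma is_derive_flat n x :
  is_derive x (1 : R) (flat n) (flat n.+2 x - n%:R * flat n.+1 x).
Proof.
case: (ltgtP x 0) => [x0|x0|->].
- rewrite !flat_le0 ?(ltW x0)// mulr0 subr0.
  apply: (@near_eq_is_derive _ _ _ (cst 0)).
    near=> y; rewrite flat_le0//; apply/ltW; near: y.
    by apply: lt_nbhsl.
- apply: (@near_eq_is_derive _ _ _ (fun y : R => expR (- y^-1) * y^-1 ^+ n)).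
    near=> y.
    have y0 : 0 < y by near: y; exact: lt_nbhsr.
    by rewrite /flat y0.
  have xn0 : x != 0 by rewrite gt_eqF.
  have dV : is_derive x (1 : R) (fun y : R => y^-1) (- x ^- 2).
    apply: is_derive_eq; first exact: (is_deriveV (f := id)).
    by rewrite [LHS]mulr1.
  have dE : is_derive x (1 : R) (fun y : R => expR (- y^-1)) (expR (- x^-1) * x ^- 2).
    have dN : is_derive x (1 : R) (fun y : R => - y^-1) (x ^- 2).
      by have := is_deriveN dV; rewrite opprK.
    have dEN := is_derive_expR (- x^-1).
    exact: (@is_derive1_comp R expR (fun y : R => - y^-1) x _ _ dEN dN).
  have dX : is_derive x (1 : R) (fun y : R => y^-1 ^+ n)
      (n%:R * x^-1 ^+ n.-1 * - x ^- 2).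
    by have := is_deriveX n dV; rewrite exprfctE.
  have := is_deriveM dE dX; rewrite mulrfctE => dM.
  apply: (@is_derive_eq _ _ _ _ _ _ _ _ dM).
  rewrite /flat x0 /= -!exprVn /GRing.scale/=; set e := expR _; set y := x^-1.
  case: n {dX dM} => [|n]; rewrite /= ?expr0 ?exprS; ring.
- rewrite !flat_le0// mulr0 subr0.
  exact: is_derive_quadratic (flat_quadratic n).
Unshelve. all: by end_near. Qed.

Lemma is_derive_fun (f g : R -> R) :
  (forall x, is_derive x (1 : R) f (g x)) -> derive1 f = g.
Proof.
move=> dfg; apply/funext => x; rewrite derive1E.
exact: (@derive_val _ _ _ _ _ _ _ (dfg x)).
Qed.

(** A space of differentiable functions stable under derivation and containing
    the bump; it spares explicit formulas for the successive derivatives. *)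
Inductive flat_span a b : (R -> R) -> Prop :=
| flat_span_prod n m :
    flat_span a b (fun x => flat n (x - a) * flat m (b - x))
| flat_span_lin c f h : flat_span a b f -> flat_span a b h ->
    flat_span a b (fun x => c * f x + h x).

Lemma flat_span_derive a b f : flat_span a b f ->
  (forall x, derivable f x 1) /\ flat_span a b (derive1 f).
Proof.
elim=> {f} [n m|c f h _ [df Sf] _ [dh Sh]].
- have dfl x : is_derive x (1 : R) (fun y => flat n (y - a) * flat m (b - y))
     (- n%:R * (flat n.+1 (x - a) * flat m (b - x)) +
      (-1 * (flat n (x - a) * flat m.+2 (b - x)) +
       (m%:R * (flat n (x - a) * flat m.+1 (b - x)) +
        flat n.+2 (x - a) * flat m (b - x)))).
    have d1 : is_derive x (1 : R) (fun y => flat n (y - a))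
        (flat n.+2 (x - a) - n%:R * flat n.+1 (x - a)).
      have di : is_derive x (1 : R) (fun y : R => y - a) 1.
        have := is_deriveB (is_derive_id x (1 : R)) (is_derive_cst a x (1 : R)).
        by rewrite subr0.
      have := @is_derive1_comp R _ _ x _ _ (is_derive_flat n (x - a)) di.
      by rewrite mulr1.
    have d2 : is_derive x (1 : R) (fun y => flat m (b - y))
        (- (flat m.+2 (b - x) - m%:R * flat m.+1 (b - x))).
      have di : is_derive x (1 : R) (fun y : R => b - y) (-1).
        have := is_deriveB (is_derive_cst b x (1 : R)) (is_derive_id x (1 : R)).
        by rewrite sub0r.
      have := @is_derive1_comp R _ _ x _ _ (is_derive_flat m (b - x)) di.
      by rewrite mulrN1.
    have := is_deriveM d1 d2; rewrite mulrfctE => dM.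
    apply: (is_derive_eq dM); rewrite /GRing.scale/=; ring.
  split=> [x|]; first by have [] := dfl x.
  rewrite (is_derive_fun dfl).
  do 3 (apply: flat_span_lin; first exact: flat_span_prod).
  exact: flat_span_prod.
- have dl x : is_derive x (1 : R) (fun y => c * f y + h y)
      (c * (derive1 f) x + (derive1 h) x).
    have /derivableP dfx := df x; have /derivableP dhx := dh x.
    have := is_deriveD (is_deriveZ c dfx) dhx.
    by rewrite !derive1E.
  split=> [x|]; first by have [] := dl x.
  rewrite (is_derive_fun dl); exact: flat_span_lin.
Qed.

Definition bump c d x : R := flat 0 (x - (c - d)) * flat 0 (c + d - x).

Lemma bump_center c d x : bump c d x = bump 0 d (x - c).
Proof. by rewrite /bump; congr (flat _ _ * flat _ _); ring. Qed.

Lemma bump_ge0 c d x : 0 <= bump c d x.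
Proof. by rewrite mulr_ge0 ?flat_ge0. Qed.

Lemma bump_out c d x : ~ (c - d < x < c + d) -> bump c d x = 0.
Proof.
move=> /negP; rewrite negb_and -!leNgt /bump => /orP[h|h].
- by rewrite flat_le0 ?mul0r// subr_le0.
- by rewrite [X in _ * X]flat_le0 ?mulr0// subr_le0.
Qed.

Lemma bump_le1 c d x : bump c d x <= 1.
Proof.
have flat_le1 y : flat 0 y <= 1.
  rewrite /flat; case: ifPn => // y0.
  by rewrite expr0 mulr1 expR_le1 oppr_le0 invr_ge0 ltW.
by rewrite mulr_ile1 ?flat_ge0.
Qed.

Lemma bump_derive1n c d n :
  flat_span (c - d) (c + d) (derive1n n (bump c d)).
Proof.
elim: n => [|n ih]; first exact: flat_span_prod.
by rewrite derive1nS; have [] := flat_span_derive ih.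
Qed.

Lemma continuous_bump c d : continuous (bump c d).
Proof.
move=> x; apply: differentiable_continuous; apply/derivable1_diffP.
by have [] := flat_span_derive (bump_derive1n c d 0).
Qed.

Lemma csmooth_bump c d : csmooth (fun x => (bump c d x)%:C).
Proof.
move=> n x; split; first by have [] := flat_span_derive (bump_derive1n c d n).
rewrite (_ : derive1n n _ = cst 0); first exact: derivable_cst.
elim: n => //= n ->; apply/funext => y; rewrite derive1E; exact: derive_cst.
Qed.

End Flat.

(** * Moduli and exponentials of complex numbers *)

Section Complex_facts.
Context {R : realType}.
Implicit Types (x y : R) (a b z : R[i]).

Lemma sqnormc_ge0 z : 0 <= sqnormc z.
Proof. by rewrite addr_ge0 ?sqr_ge0. Qed.

Lemma sqnormc0 : sqnormc (0 : R[i]) = 0.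
Proof. by rewrite /sqnormc /= expr0n addr0. Qed.

Lemma sqnormc_eq0 z : sqnormc z = 0 -> z = 0.
Proof.
case: z => a b /eqP; rewrite /sqnormc/= paddr_eq0 ?sqr_ge0// !sqrf_eq0.
by case/andP=> /eqP -> /eqP ->.
Qed.

Lemma sqnormcM a b : sqnormc (a * b) = sqnormc a * sqnormc b.
Proof. case: a b => a1 a2 [b1 b2]; rewrite /sqnormc /=; ring. Qed.

Lemma sqnormc_real x : sqnormc x%:C = x ^+ 2.
Proof. by rewrite /sqnormc /= expr0n addr0. Qed.

Lemma sqnormcN z : sqnormc (- z) = sqnormc z.
Proof. by case: z => a b; rewrite /sqnormc /= !sqrrN. Qed.

Lemma expiD x y : expi (x + y) = expi x * expi y.
Proof.
rewrite /expi mulrDr cosD sinD; congr (_ +i* _).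
by rewrite addrC.
Qed.

Lemma expi0 : expi 0 = 1 :> R[i].
Proof. by rewrite /expi mulr0 cos0 sin0. Qed.

Lemma sqnormc_expi x : sqnormc (expi x) = 1.
Proof. exact: cos2Dsin2. Qed.

Lemma sqnormcD a b : sqnormc (a + b) <= 2 * (sqnormc a + sqnormc b).
Proof.
case: a b => a1 a2 [b1 b2]; rewrite /sqnormc /=.
by have := sqr_ge0 (a1 - b1); have := sqr_ge0 (a2 - b2); lra.
Qed.

(** Cauchy-Schwarz inequality for a sum of [K] terms, proved by induction with
    (p + r)^2 <= (1 + 1/K) p^2 + (1 + K) r^2. *)
Lemma sqnormc_sum (K : nat) (u : nat -> R[i]) :
  sqnormc (\sum_(0 <= j < K) u j) <= K%:R * \sum_(0 <= j < K) sqnormc (u j).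
Proof.
elim: K => [|K ih]; first by rewrite !big_geq// sqnormc0 mul0r.
case: K ih => [|K] ih; first by rewrite !big_nat1 mul1r.
rewrite big_nat_recr// [X in _ <= _ * X]big_nat_recr//=.
set s := \sum_(0 <= _ < _) u _ in ih *.
set q := \sum_(0 <= _ < _) sqnormc _ in ih *; set v := u _.
set k := K.+1 in s q ih v *.
have K1 : 0 < k%:R :> R by rewrite ltr0n.
have qge : sqnormc s / k%:R <= q by rewrite ler_pdivrMr// [q * _]mulrC.
have : sqnormc (s + v) <= (1 + k%:R^-1) * sqnormc s + (1 + k%:R) * sqnormc v.
  case: (s) (v) => s1 s2 [v1 v2]; rewrite /sqnormc /=.
  have two (p r : R) : (p + r) ^+ 2 <= (1 + k%:R^-1) * p ^+ 2 + (1 + k%:R) * r ^+ 2.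
    rewrite -subr_ge0.
    suff -> : (1 + k%:R^-1) * p ^+ 2 + (1 + k%:R) * r ^+ 2 - (p + r) ^+ 2
        = k%:R^-1 * (p - k%:R * r) ^+ 2.
      by rewrite mulr_ge0 ?sqr_ge0 ?invr_ge0 ?ler0n.
    by field; rewrite gt_eqF.
  by have := two s1 v1; have := two s2 v2; lra.
have -> : (1 + k%:R^-1) * sqnormc s = (1 + k%:R) * (sqnormc s / k%:R).
  by field; rewrite gt_eqF.
move=> h; apply: (le_trans h); rewrite -mulrDr.
have -> : k.+1%:R = 1 + k%:R :> R by rewrite -natr1 addrC.
by rewrite ler_pM2l ?lerD2r// addr_gt0.
Qed.

(** The mean value theorem with the derivative controlled only on the
    symmetric interval ending at [x], so that each Taylor bound feeds the next one. *)
Lemma derive_bound (f df : R -> R) (M x : R) :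
  (forall y, is_derive y (1 : R) f (df y)) ->
  (forall y, `|y| <= `|x| -> `|df y| <= M) -> `|f x - f 0| <= M * `|x|.
Proof.
move=> dfE dfM.
have cf : continuous f.
  move=> y; apply: differentiable_continuous; apply/derivable1_diffP.
  by have [] := dfE y.
case: (leP 0 x) => [x0|/ltW x0].
- have [c] := @MVT_segment R f df 0 x x0 (fun y _ => dfE y)
    (continuous_subspaceT cf).
  rewrite in_itv/= => /andP[c0 cx] ->; rewrite subr0 normrM ler_wpM2r//.
  by apply: dfM; rewrite !ger0_norm.
- have [c] := @MVT_segment R f df x 0 x0 (fun y _ => dfE y)
    (continuous_subspaceT cf).
  rewrite in_itv/= => /andP[c0 cx]; rewrite distrC => ->.
  rewrite sub0r normrM normrN ler_wpM2r//.
  by apply: dfM; rewrite !ler0_norm// lerN2.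
Qed.

Lemma norm_sin_le x : `|sin x| <= `|x|.
Proof.
have := @derive_bound sin cos 1 x (is_derive_sin (R := R)).
by rewrite sin0 subr0 mul1r; apply=> y _; exact: cos_max.
Qed.

Lemma norm_cosB1_le x : `|cos x - 1| <= x ^+ 2.
Proof.
have h : `|cos x - cos 0| <= `|x| * `|x|.
  apply: (derive_bound (df := fun y => - sin y)) => y yx.
  by rewrite normrN (le_trans (norm_sin_le y)).
by rewrite cos0 -normrM -expr2 [X in _ <= X]ger0_norm ?sqr_ge0 in h.
Qed.

Lemma norm_sinB_le x : `|sin x - x| <= x ^+ 2 * `|x|.
Proof.
have h : `|(sin x - x) - (sin 0 - 0)| <= x ^+ 2 * `|x|.
  apply: (derive_bound (f := fun y => sin y - y) (df := fun y => cos y - 1)).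
  move=> y yx; apply: (le_trans (norm_cosB1_le y)).
  rewrite -(ger0_norm (sqr_ge0 y)) -(ger0_norm (sqr_ge0 x)) !normrX.
  by rewrite lerXn2r ?nnegrE.
by rewrite sin0 subrr subr0 in h.
Qed.

(** The remainder is of order 2, so its square is of order 4: it stays
    negligible after multiplication by the squared number of time steps, which is
    of order x^-2 when [x] is proportional to the step. *)
Lemma sqnormc_expi_taylor x : sqnormc (expi x - 1 - two_pi_i * x%:C) <=
  (2 * pi * x) ^+ 4 + (2 * pi * x) ^+ 6.
Proof.
set t := 2 * pi * x.
have -> : expi x - 1 - two_pi_i * x%:C = (cos t - 1) +i* (sin t - t).
  rewrite /expi /two_pi_i -/t; apply/eqP; rewrite eq_complex /=; apply/andP.
  by split; apply/eqP; rewrite /t; ring.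
rewrite /sqnormc /= lerD//.
- rewrite -[X in X <= _]ger0_norm ?sqr_ge0// normrX.
  have -> : t ^+ 4 = (t ^+ 2) ^+ 2 by rewrite -exprM.
  by rewrite lerXn2r ?nnegrE ?sqr_ge0// norm_cosB1_le.
- rewrite -[X in X <= _]ger0_norm ?sqr_ge0// normrX.
  have -> : t ^+ 6 = (t ^+ 2 * `|t|) ^+ 2.
    by rewrite [RHS]exprMn real_normK ?num_real// -exprM -exprD.
  have h := norm_sinB_le t.
  by rewrite lerXn2r ?nnegrE// (le_trans (normr_ge0 _) h).
Qed.

End Complex_facts.

(** * The Fourier transform of a bump *)

Section Fourier_bump.
Context {R : realType}.
Implicit Types (c d x lam : R).
Local Notation leb := (@lebesgue_measure R).

Lemma measurable_shift c :
  measurable_fun [set: measurableTypeR R] 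
    ((fun x => x - c) : measurableTypeR R -> measurableTypeR R).
Proof. exact: measurable_funD. Qed.

Lemma lebesgue_measure_shift c (A : set R) : measurable A ->
  pushforward leb ((fun x => x - c) : _ -> measurableTypeR R) A = leb A.
Proof.
pose f : {mfun measurableTypeR R >-> measurableTypeR R} := MeasurableFun.Pack
  (MeasurableFun.Class (isMeasurableFun.Build _ _ (measurableTypeR R)
    (measurableTypeR R) (fun x => x - c) (measurable_shift c))).
move=> mA; rewrite -[LHS]/(pushforward leb f A).
apply/esym/lebesgue_measure_unique => //= _ [[a b]] _ <-.
rewrite /pushforward (_ : _ @^-1` _ = `]a + c, b + c]%classic); last first.
  by apply/seteqP; split=> x /=; rewrite !in_itv/= ltrBrDr lerBlDr.
rewrite !lebesgue_measure_itv/= !lte_fin ltrD2r.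
by case: ifP => // _; congr (_%:E); ring.
Qed.

Lemma integral_shift (f : R -> \bar R) c : measurable_fun [set: R] f ->
  (\int[leb]_x f (x - c)%R = \int[leb]_x f x)%E.
Proof.
have ge0 (g : R -> \bar R) : measurable_fun [set: R] g -> (forall x, 0 <= g x)%E ->
    (\int[leb]_x g (x - c)%R = \int[leb]_x g x)%E.
  move=> mg g0; transitivity
      (\int[pushforward leb ((fun x => x - c)%R : _ -> measurableTypeR R)]_x g x)%E.
    rewrite ge0_integral_pushforward//; exact: measurable_shift.
  apply: eq_measure_integral => [|mc A mA _]; first exact: measurable_shift.
  exact: (lebesgue_measure_shift c mA).
move=> mf; rewrite integralE [RHS]integralE; congr (_ - _)%E.
- rewrite -[RHS](ge0 _ (measurable_funepos mf))//.
  by apply: eq_integral => x _; rewrite !funeposE.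
- rewrite -[RHS](ge0 _ (measurable_funeneg mf))//.
  by apply: eq_integral => x _; rewrite !funenegE.
Qed.

Lemma Rintegral_shift (f : R -> R) c : measurable_fun [set: R] f ->
  \int[leb]_x f (x - c) = \int[leb]_x f x.
Proof.
move=> mf; rewrite /Rintegral; congr fine.
by rewrite (integral_shift (f := EFin \o f))//; exact/measurable_EFinP.
Qed.

Lemma measurable_bump c d : measurable_fun [set: R] (bump c d).
Proof. by apply: continuous_measurable_fun; exact: continuous_bump. Qed.

Lemma measurable_cosM lam : measurable_fun [set: R] (fun x => cos (lam * x)).
Proof.
apply: continuous_measurable_fun => x.
by apply: continuous_comp; [exact: mulrl_continuous|exact: continuous_cos].
Qed.

Lemma measurable_sinM lam : measurable_fun [set: R] (fun x => sin (lam * x)).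
Proof.
apply: continuous_measurable_fun => x.
by apply: continuous_comp; [exact: mulrl_continuous|exact: continuous_sin].
Qed.

Lemma integrable_bumpM c d (f : R -> R) : measurable_fun [set: R] f ->
  (forall x, `|f x| <= 1) ->
  leb.-integrable setT (EFin \o (fun x => bump c d x * f x)).
Proof.
move=> mf f1.
apply: (le_integrable measurableT _ _ (@integrable_indic_itv R (c - d) (c + d) true false)).
  by apply/measurable_EFinP; apply: measurable_funM => //; exact: measurable_bump.
move=> x _ /=; rewrite lee_fin indicE.
have [xcd|xcd] := boolP (x \in _).
  rewrite normr1 normrM mulr_ile1//.
  by rewrite ger0_norm ?bump_ge0 ?bump_le1.
rewrite bump_out ?mul0r ?normr0//.
move=> /andP[h1 h2]; move/negP: xcd; apply; rewrite inE/= in_itv/=.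
by rewrite (ltW h1) (ltW h2).
Qed.

Lemma integrable_scale k (f : R -> R) : leb.-integrable setT (EFin \o f) ->
  leb.-integrable setT (EFin \o (fun x => k * f x)).
Proof.
move=> intf; rewrite (_ : _ \o _ = fun x => k%:E * (EFin \o f) x)%E//.
exact: integrableZl.
Qed.

Lemma fourier_bump c d lam : fourier (fun x => (bump c d x)%:C) lam =
  expi (- (lam * c)) * fourier (fun x => (bump 0 d x)%:C) lam.
Proof.
set w := - (2 * pi * lam).
have fE c' : fourier (fun x => (bump c' d x)%:C) lam =
    (\int[leb]_x (bump c' d x * cos (w * x))) +i*
    (\int[leb]_x (bump c' d x * sin (w * x))).
  rewrite /fourier /cintegral; congr (_ +i* _); apply: eq_Rintegral => x _ /=.
    by rewrite mul0r subr0; congr (_ * cos _); rewrite /w; ring.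
  by rewrite mul0r addr0; congr (_ * sin _); rewrite /w; ring.
have ic := integrable_bumpM 0 d (measurable_cosM w) (fun x => cos_max (w * x)).
have is_ := integrable_bumpM 0 d (measurable_sinM w) (fun x => sin_max (w * x)).
rewrite !fE.
have -> : expi (- (lam * c)) = cos (w * c) +i* sin (w * c).
  by rewrite /expi; congr (cos _ +i* sin _); rewrite /w; ring.
have mb := measurable_bump 0 d.
have mc := measurable_cosM w; have ms := measurable_sinM w.
have -> : \int[leb]_x (bump c d x * cos (w * x)) =
   \int[leb]_x (bump 0 d x * cos (w * (x + c))).
  rewrite -(@Rintegral_shift (fun x => bump 0 d x * cos (w * (x + c))) c).
    by apply: eq_Rintegral => x _; rewrite (bump_center c) subrK.
  apply: measurable_funM => //.
  apply: (measurableT_comp (f := fun x => cos (w * x))) => //.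
  exact: measurable_funD.
have -> : \int[leb]_x (bump c d x * sin (w * x)) =
   \int[leb]_x (bump 0 d x * sin (w * (x + c))).
  rewrite -(@Rintegral_shift (fun x => bump 0 d x * sin (w * (x + c))) c).
    by apply: eq_Rintegral => x _; rewrite (bump_center c) subrK.
  apply: measurable_funM => //.
  apply: (measurableT_comp (f := fun x => sin (w * x))) => //.
  exact: measurable_funD.
apply/eqP; rewrite eq_complex /=; apply/andP; split; apply/eqP.
  rewrite -!RintegralZl// -RintegralB//=; [|exact: integrable_scale..].
  by apply: eq_Rintegral => x _; rewrite mulrDr cosD; ring.
rewrite -!RintegralZl// -RintegralD//=; [|exact: integrable_scale..].
by apply: eq_Rintegral => x _; rewrite mulrDr sinD; ring.
Qed.

(** While the phase [2 * pi * lam * x] stays below 1/2 on the support, its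
    cosine is at least 1/2 there, and nothing cancels in the real part; the
    constant is a lower bound of the mass of the bump on the middle half of its
    support. *)
Lemma fourier_bump_lb d lam : 0 < d -> 2 * pi * `|lam| * d <= 2^-1 ->
  (expR (- (d / 2)^-1) ^+ 2 * d / 2) ^+ 2 <=
  sqnormc (fourier (fun x => (bump 0 d x)%:C) lam).
Proof.
move=> d0 hd; set e := expR _.
rewrite /sqnormc; apply: ler_wpDr; first exact: sqr_ge0.
have e0 : 0 < e by exact: expR_gt0.
have c0 : 0 <= e ^+ 2 * d / 2 by rewrite divr_ge0// mulr_ge0 ?sqr_ge0// ltW.
suff h : e ^+ 2 * d / 2 <= complex.Re (fourier (fun x => (bump 0 d x)%:C) lam).
  by rewrite lerXn2r ?nnegrE// (le_trans c0).
pose w := - (2 * pi * lam).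
have -> : complex.Re (fourier (fun x => (bump 0 d x)%:C) lam) =
    \int[leb]_x (bump 0 d x * cos (w * x)).
  apply: eq_Rintegral => x _ /=.
  by rewrite mul0r subr0; congr (_ * cos _); rewrite /w; ring.
pose J := `[- (d / 2), d / 2]%classic.
have mJ : measurable (J : set (measurableTypeR R)) by exact: measurable_itv.
have iJ : leb.-integrable setT (EFin \o (\1_J : R -> R)).
  exact: integrable_indic_itv.
have -> : e ^+ 2 * d / 2 = \int[leb]_x (e ^+ 2 / 2 * \1_J x).
  have mJd : lebesgue_measure J = d%:E :> \bar R.
    rewrite /J lebesgue_measure_itv/= lte_fin ifT; last by lra.
    by rewrite -EFinD; congr EFin; field.
  rewrite RintegralZl// /Rintegral integral_indic// setIT.
  transitivity (e ^+ 2 / 2 * fine d%:E); first by rewrite /=; field.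
  by congr (_ * fine _); rewrite -mJd.
apply: le_Rintegral => //.
- exact: integrable_scale.
- exact: integrable_bumpM (measurable_cosM w) (fun x => cos_max (w * x)).
move=> x _.
have [xd|xd] := boolP (- d < x < d); last first.
  rewrite bump_out; last by rewrite sub0r add0r; exact/negP.
  rewrite mul0r indicE memNset ?mulr0// /J/= in_itv/= => /andP[h1 h2].
  by move/negP: xd; apply; apply/andP; split; lra.
have xdn : `|x| <= d by rewrite ler_norml !ltW//; case/andP: xd.
have hc : 2^-1 <= cos (w * x).
  have := norm_cosB1_le (w * x); rewrite ler_norml => /andP[h _].
  have : (w * x) ^+ 2 <= (2^-1) ^+ 2.
    rewrite -[X in X <= _]ger0_norm ?sqr_ge0// normrX lerXn2r ?nnegrE//.
    apply: le_trans hd; rewrite normrM /w normrN normrM.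
    rewrite [X in X * _ * _]ger0_norm ?mulr_ge0 ?pi_ge0//.
    by rewrite ler_wpM2l// mulr_ge0// mulr_ge0 ?pi_ge0.
  by rewrite expr2; lra.
apply: (@le_trans _ _ (bump 0 d x * 2^-1)); last by rewrite ler_wpM2l ?bump_ge0.
rewrite mulrAC ler_pM2r ?invr_gt0//.
rewrite indicE; have [|_] := boolP (x \in J); last by rewrite mulr0 bump_ge0.
rewrite inE /J/= in_itv/= => /andP[h1 h2]; rewrite mulr1.
have fl y : d / 2 <= y -> e <= flat 0 y.
  move=> dy; have y0 : 0 < y by apply: lt_le_trans dy; rewrite divr_gt0.
  rewrite /flat y0 expr0 mulr1 /e ler_expR lerN2 lef_pV2// ?posrE//.
  by rewrite divr_gt0.
by rewrite /bump expr2 ler_pM ?(ltW e0)//; apply: fl; lra.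
Qed.

End Fourier_bump.

(** * Sections of the direct integral *)

Section Cmeasurable.
Context {R : realType}.
Variables (D : set R).
Implicit Types (f g : R -> R[i]).

Lemma cmeasurable_cst (c : R[i]) : cmeasurable D (fun=> c).
Proof. by split; exact: measurable_cst. Qed.

Lemma cmeasurableD f g : cmeasurable D f -> cmeasurable D g ->
  cmeasurable D (fun x => f x + g x).
Proof.
move=> [f1 f2] [g1 g2]; split.
- rewrite (_ : (fun _ => _) = fun x => complex.Re (f x) + complex.Re (g x)).
    exact: measurable_funD.
  by apply/funext => x; case: (f x) (g x) => ? ? [? ?].
- rewrite (_ : (fun _ => _) = fun x => complex.Im (f x) + complex.Im (g x)).
    exact: measurable_funD.
  by apply/funext => x; case: (f x) (g x) => ? ? [? ?].
Qed.

Lemma cmeasurableM f g : cmeasurable D f -> cmeasurable D g ->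
  cmeasurable D (fun x => f x * g x).
Proof.
move=> [f1 f2] [g1 g2]; split.
- rewrite (_ : (fun _ => _) = fun x => complex.Re (f x) * complex.Re (g x)
      - complex.Im (f x) * complex.Im (g x)).
    by apply: measurable_funB; exact: measurable_funM.
  by apply/funext => x; case: (f x) (g x) => ? ? [? ?].
- rewrite (_ : (fun _ => _) = fun x => complex.Re (f x) * complex.Im (g x)
      + complex.Im (f x) * complex.Re (g x)).
    by apply: measurable_funD; exact: measurable_funM.
  by apply/funext => x; case: (f x) (g x) => ? ? [? ?].
Qed.

Lemma cmeasurableB f g : cmeasurable D f -> cmeasurable D g ->
  cmeasurable D (fun x => f x - g x).
Proof.
move=> mf mg; rewrite (_ : (fun _ => _) = fun x => f x + (-1) * g x).
  by apply: cmeasurableD => //; apply: cmeasurableM => //; exact: cmeasurable_cst.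
by apply/funext => x; rewrite mulN1r.
Qed.

Lemma cmeasurable_sum (J : Type) (r : seq J) (f : J -> R -> R[i]) :
  (forall j, cmeasurable D (f j)) -> cmeasurable D (fun x => \sum_(j <- r) f j x).
Proof.
move=> mf; elim: r => [|j r ih].
  rewrite (_ : (fun _ => _) = fun=> 0); first exact: cmeasurable_cst.
  by apply/funext => x; rewrite big_nil.
rewrite (_ : (fun _ => _) = fun x => f j x + \sum_(i <- r) f i x).
  exact: cmeasurableD.
by apply/funext => x; rewrite big_cons.
Qed.

Lemma cmeasurable_scale (a : R) : cmeasurable D (fun x : R => (a * x)%:C).
Proof.
split=> /=; last exact: measurable_cst.
by apply: measurable_funM; [exact: measurable_cst|exact: measurable_id].
Qed.

Lemma cmeasurable_expi (a : R) : cmeasurable D (fun x => expi (x * a)).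
Proof.
split.
- apply: (measurable_funS (E := setT)) => //.
  rewrite (_ : (fun _ => _) = fun x => cos ((2 * pi * a) * x)).
    exact: measurable_cosM.
  by apply/funext => x /=; congr cos; ring.
- apply: (measurable_funS (E := setT)) => //.
  rewrite (_ : (fun _ => _) = fun x => sin ((2 * pi * a) * x)).
    exact: measurable_sinM.
  by apply/funext => x /=; congr sin; ring.
Qed.

End Cmeasurable.

Section Energy.
Context {R : realType}.
Variables (mu : {measure set (measurableTypeR R) -> \bar R}).
Variables (m : R -> option nat).
Implicit Types (g h : R -> nat -> R[i]) (A : set R) (lam : R).

(** Measurability is asked only where the coordinate [n] is present: the other
    values of a matrix field are arbitrary, and the fibre norm ignores them. *)
Definition measurable_section g : Prop :=
  forall n, cmeasurable [set lam | below n (m lam)] (fun lam => g lam n).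

Lemma ae_sub (P Q : R -> Prop) : {ae mu, forall x, P x} ->
  (forall x, P x -> Q x) -> {ae mu, forall x, Q x}.
Proof. by move=> hP PQ; apply: negligibleS hP => x; exact: contra_not (PQ x). Qed.

Lemma ae_and (P Q : R -> Prop) : {ae mu, forall x, P x} -> {ae mu, forall x, Q x} ->
  {ae mu, forall x, P x /\ Q x}.
Proof.
move=> hP hQ; have := @negligibleU _ _ _ mu _ _ hP hQ.
by apply: negligibleS => x /= /not_andP.
Qed.

Definition energy A g : \bar R := (\int[mu]_(lam in A) fiber_sqnorm m g lam)%E.

Lemma fiber_sqnorm_ge0 g lam : (0 <= fiber_sqnorm m g lam)%E.
Proof. by apply: nneseries_ge0 => n _ _; rewrite lee_fin sqnormc_ge0. Qed.

Lemma energy_ge0 A g : (0 <= energy A g)%E.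
Proof. by apply: integral_ge0 => lam _; exact: fiber_sqnorm_ge0. Qed.

Lemma eq_fiber_sqnorm g h lam :
  (forall n, below n (m lam) -> g lam n = h lam n) ->
  fiber_sqnorm m g lam = fiber_sqnorm m h lam.
Proof. by move=> gh; apply: eq_eseriesr => n /gh ->. Qed.

Lemma fiber_sqnorm_dominate (c : R) (K : nat) (u : nat -> R -> nat -> R[i]) g lam :
  0 <= c ->
  (forall n, below n (m lam) ->
    sqnormc (g lam n) <= c * \sum_(0 <= j < K) sqnormc (u j lam n)) ->
  (fiber_sqnorm m g lam <= c%:E * \sum_(0 <= j < K) fiber_sqnorm m (u j) lam)%E.
Proof.
move=> c0 h.
rewrite [leRHS](_ : _ = \sum_(0 <= n <oo | below n (m lam))
    (c%:E * \sum_(0 <= j < K) (sqnormc (u j lam n))%:E))%E; last first.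
  rewrite nneseriesZl; last first.
    by move=> n _; apply: sume_ge0 => j _; rewrite lee_fin sqnormc_ge0.
  congr (_ * _)%E; elim: K {h} => [|K ih].
    rewrite big_geq//; under eq_eseriesr do rewrite big_geq//.
    by rewrite eseries0.
  rewrite big_nat_recr//= ih; under [in RHS]eq_eseriesr do rewrite big_nat_recr//=.
  rewrite nneseriesD// => n _ _; rewrite ?lee_fin ?sqnormc_ge0//.
  by apply: sume_ge0 => j _; rewrite lee_fin sqnormc_ge0.
apply: lee_nneseries => n; first by rewrite lee_fin sqnormc_ge0.
by move=> /h h'; rewrite sumEFin -EFinM lee_fin.
Qed.

Lemma sqnormc_le_fiber g lam n : below n (m lam) ->
  ((sqnormc (g lam n))%:E <= fiber_sqnorm m g lam)%E.
Proof.
move=> bn; rewrite /fiber_sqnorm (nneseriesD1 _ bn); last first.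
  by move=> k _; rewrite lee_fin sqnormc_ge0.
by rewrite leeDl// nneseries_ge0// => k _ _; rewrite lee_fin sqnormc_ge0.
Qed.

Lemma fiber_sqnorm_eq0 g lam n :
  fiber_sqnorm m g lam = 0%E -> below n (m lam) -> g lam n = 0.
Proof.
move=> g0 /(sqnormc_le_fiber g); rewrite g0 lee_fin => gle.
by apply: sqnormc_eq0; apply/eqP; rewrite eq_le gle sqnormc_ge0.
Qed.

Hypothesis mult_m : multiplicity_function m.

Lemma measurable_below n : measurable [set lam : R | below n (m lam)].
Proof.
rewrite (_ : mkset _ = ~` \bigcup_(k in [set k | (k <= n)%N]) [set lam | m lam = Some k]).
  by apply: measurableC; apply: bigcup_measurable => k _; exact: mult_m.
apply/seteqP; split=> lam /=.
- move=> blam -[k /= kn mk].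
  by move: blam; rewrite mk/= => /leq_trans/(_ kn); rewrite ltnn.
- move=> h; rewrite /below; case E: (m lam) => [k|//].
  by rewrite ltnNge; apply/negP => kn; apply: h; exists k.
Qed.

Lemma measurable_fiber_sqnorm g : measurable_section g ->
  measurable_fun [set: R] (fiber_sqnorm m g).
Proof.
move=> mg; rewrite (_ : fiber_sqnorm m g = fun lam => \sum_(0 <= n <oo | n \in xpredT)
    (((fun lam => (sqnormc (g lam n))%:E) \_ [set lam | below n (m lam)]) lam))%E.
  apply: ge0_emeasurable_sum => n.
    move=> lam _ _; rewrite patchE; case: ifP => // _.
    by rewrite lee_fin sqnormc_ge0.
  move=> _; apply/(measurable_restrictT _ (measurable_below n)).
  have [mg1 mg2] := mg n.
  by apply/measurable_EFinP; apply: measurable_funD; exact: measurable_funX.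
apply/funext => lam; rewrite /fiber_sqnorm eseries_mkcond; apply: eq_eseriesr => n _.
by rewrite patchE mem_setE.
Qed.

(** Pointwise domination by finitely many sections, almost everywhere and on
    [A] only, passes to squared norms in the direct integral. The estimates in the
    spectral representation are instances of this one. *)
Lemma ae_energy_dominate A (c : R) (K : nat) (u : nat -> R -> nat -> R[i]) g :
  measurable A -> 0 <= c ->
  measurable_section g -> (forall j, measurable_section (u j)) ->
  {ae mu, forall lam, A lam -> forall n, below n (m lam) ->
    sqnormc (g lam n) <= c * \sum_(0 <= j < K) sqnormc (u j lam n)} ->
  (energy A g <= c%:E * \sum_(0 <= j < K) energy A (u j))%E.
Proof.
move=> mA c0 mg mu_ h.
have mfib v : measurable_section v -> measurable_fun A (fiber_sqnorm m v).
  by move=> mv; apply: measurable_funTS; exact: measurable_fiber_sqnorm.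
rewrite /energy -ge0_integral_sum//; last 2 first.
  by move=> j; exact: mfib.
  by move=> *; exact: fiber_sqnorm_ge0.
have ms : measurable_fun A (fun lam => \sum_(0 <= j < K) fiber_sqnorm m (u j) lam)%E.
  by apply: emeasurable_sum => j; exact: mfib.
have s0 lam : (0 <= \sum_(0 <= j < K) fiber_sqnorm m (u j) lam)%E.
  by apply: sume_ge0 => j _; exact: fiber_sqnorm_ge0.
rewrite -ge0_integralZl_EFin//; apply: ae_ge0_le_integral => //.
- by move=> lam _; exact: fiber_sqnorm_ge0.
- exact: mfib.
- by move=> lam _; rewrite mule_ge0.
- exact: measurable_funeM.
- by apply: (ae_sub h) => lam hlam Alam; exact: fiber_sqnorm_dominate (hlam Alam).
Qed.

Lemma energy_dominate A (c : R) (K : nat) (u : nat -> R -> nat -> R[i]) g :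
  measurable A -> 0 <= c ->
  measurable_section g -> (forall j, measurable_section (u j)) ->
  (forall lam n, A lam -> below n (m lam) ->
    sqnormc (g lam n) <= c * \sum_(0 <= j < K) sqnormc (u j lam n)) ->
  (energy A g <= c%:E * \sum_(0 <= j < K) energy A (u j))%E.
Proof.
move=> mA c0 mg mu_ h; apply: ae_energy_dominate => //.
by apply: aeW => lam Alam n; exact: h.
Qed.

Lemma energy_ae_eq A g h : measurable A ->
  measurable_section g -> measurable_section h ->
  {ae mu, forall lam, A lam -> forall n, below n (m lam) -> g lam n = h lam n} ->
  energy A g = energy A h.
Proof.
move=> mA mg mh gh; apply: ge0_ae_eq_integral => //.
- by apply: measurable_funTS; exact: measurable_fiber_sqnorm.
- by apply: measurable_funTS; exact: measurable_fiber_sqnorm.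
- by move=> lam _; exact: fiber_sqnorm_ge0.
- by move=> lam _; exact: fiber_sqnorm_ge0.
- by apply: (ae_sub gh) => lam ghl Alam; apply: eq_fiber_sqnorm; exact: ghl.
Qed.

Lemma energy_eq0 A g : measurable A -> measurable_section g -> energy A g = 0%E ->
  {ae mu, forall lam, A lam -> forall n, below n (m lam) -> g lam n = 0}.
Proof.
move=> mA mg g0.
have mf : measurable_fun A (fiber_sqnorm m g).
  by apply: measurable_funTS; exact: measurable_fiber_sqnorm.
have : (\int[mu]_(lam in A) `|fiber_sqnorm m g lam| = 0)%E.
  rewrite -[RHS]g0; apply: eq_integral => lam _.
  by rewrite gee0_abs ?fiber_sqnorm_ge0.
move=> /(ae_eq_integral_abs mu mA mf) fib0.
apply: (ae_sub fib0) => lam h /h h' n; exact: fiber_sqnorm_eq0.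
Qed.

Lemma energy_subset A B g : measurable A -> measurable B -> measurable_section g ->
  A `<=` B -> (energy A g <= energy B g)%E.
Proof.
move=> mA mB mg AB; apply: ge0_subset_integral => //.
- by apply: measurable_funTS; exact: measurable_fiber_sqnorm.
- by move=> lam _; exact: fiber_sqnorm_ge0.
Qed.

End Energy.

(** * Unitary groups and first-order defects *)

Section L2_facts.
Context {R : realType}.
Variables (Om : set R).
Implicit Types (f g h : R -> R[i]).
Local Notation leb := (@lebesgue_measure R).

Lemma measurable_sqnormc f : cmeasurable setT f ->
  measurable_fun [set: R] (fun x => (sqnormc (f x))%:E).
Proof.
move=> [f1 f2]; apply/measurable_EFinP.
by apply: measurable_funD; exact: measurable_funX.
Qed.

Lemma sqnorm_ge0 f : (0 <= sqnorm f)%E.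
Proof. by apply: integral_ge0 => x _; rewrite lee_fin sqnormc_ge0. Qed.

Lemma sqnorm_eq_ae f g : cmeasurable setT f -> cmeasurable setT g ->
  eq_ae f g -> sqnorm f = sqnorm g.
Proof.
move=> mf mg fg; apply: ge0_ae_eq_integral => //.
- exact: measurable_sqnormc.
- exact: measurable_sqnormc.
- by move=> x _; rewrite lee_fin sqnormc_ge0.
- by move=> x _; rewrite lee_fin sqnormc_ge0.
- by apply: (ae_sub fg) => x -> _.
Qed.

Lemma sqnormZ (a : R[i]) f : cmeasurable setT f ->
  sqnorm (fun x => a * f x) = ((sqnormc a)%:E * sqnorm f)%E.
Proof.
move=> mf; rewrite /sqnorm -ge0_integralZl_EFin//.
- by apply: eq_integral => x _; rewrite sqnormcM EFinM.
- by move=> x _; rewrite lee_fin sqnormc_ge0.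
- exact: measurable_sqnormc.
- exact: sqnormc_ge0.
Qed.

Lemma in_L2_lin (a : R[i]) f g : in_L2 Om f -> in_L2 Om g ->
  in_L2 Om (fun x => a * f x + g x).
Proof.
move=> [mf f0 foo] [mg g0 goo].
have maf : cmeasurable setT (fun x => a * f x).
  by apply: cmeasurableM => //; exact: cmeasurable_cst.
split.
- exact: cmeasurableD.
- by move=> x xO; rewrite f0// g0// mulr0 addr0.
- apply: (@le_lt_trans _ _ (\int[leb]_x (2%:E * ((sqnormc (a * f x))%:E + (sqnormc (g x))%:E)))%E).
    apply: ge0_le_integral => //.
    + by move=> x _; rewrite lee_fin sqnormc_ge0.
    + by apply: measurable_sqnormc; exact: cmeasurableD.
    + apply: measurable_funeM; apply: emeasurable_funD; exact: measurable_sqnormc.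
    + by move=> x _; rewrite -EFinD -EFinM lee_fin sqnormcD.
  rewrite ge0_integralZl_EFin//; last 2 first.
  + by move=> x _; rewrite -EFinD lee_fin addr_ge0 ?sqnormc_ge0.
  + by apply: emeasurable_funD; exact: measurable_sqnormc.
  rewrite ge0_integralD//; [|by move=> x _; rewrite lee_fin sqnormc_ge0
    |exact: measurable_sqnormc|by move=> x _; rewrite lee_fin sqnormc_ge0
    |exact: measurable_sqnormc].
  rewrite lte_mul_pinfty ?lte_fin// lte_add_pinfty//.
  by rewrite -/(sqnorm (fun x => a * f x)) sqnormZ// lte_mul_pinfty// lee_fin sqnormc_ge0.
Qed.

Lemma inner_sqnorm f : inner f f = (fine (sqnorm f))%:C.
Proof.
rewrite /inner /cintegral; congr (_ +i* _).
- rewrite /Rintegral /sqnorm; congr fine; apply: eq_integral => x _.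
  by rewrite /sqnormc; case: (f x) => a b /=; congr (_%:E); ring.
- rewrite /Rintegral integral0_eq// => x _.
  by case: (f x) => a b /=; congr (_%:E); ring.
Qed.

Lemma eq_ae_trans f g h : eq_ae f g -> eq_ae g h -> eq_ae f h.
Proof.
by move=> fg gh; apply: (ae_sub (ae_and fg gh)) => x [-> ->].
Qed.

Lemma eq_ae_sym f g : eq_ae f g -> eq_ae g f.
Proof. by move=> fg; apply: (ae_sub fg). Qed.

Lemma eq_ae_lin (a : R[i]) f f' g g' : eq_ae f f' -> eq_ae g g' ->
  eq_ae (fun x => a * f x + g x) (fun x => a * f' x + g' x).
Proof.
by move=> ff gg; apply: (ae_sub (ae_and ff gg)) => x [-> ->].
Qed.

Section Unitary.
Variables (U : R -> (R -> R[i]) -> R -> R[i]) (grpU : unitary_group Om U).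

Lemma unitary_sqnorm t f : in_L2 Om f -> sqnorm (U t f) = sqnorm f.
Proof.
move=> Lf; have LU := ugrp_L2 grpU t Lf.
have := ugrp_inner grpU t Lf Lf; rewrite !inner_sqnorm => -[] h.
have fin g : in_L2 Om g -> sqnorm g \is a fin_num.
  by case=> _ _ ?; rewrite ge0_fin_numE ?sqnorm_ge0.
by rewrite -(fineK (fin _ LU)) h fineK ?fin.
Qed.

Lemma unitary_lin2 t (a b : R[i]) f g h :
  in_L2 Om f -> in_L2 Om g -> in_L2 Om h ->
  eq_ae (U t (fun x => a * f x + (b * g x + h x)))
        (fun x => a * U t f x + (b * U t g x + U t h x)).
Proof.
move=> Lf Lg Lh.
apply: eq_ae_trans (ugrp_linear grpU t a Lf (in_L2_lin b Lg Lh)) _.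
by apply: eq_ae_lin; [exact: aeW|exact: (ugrp_linear grpU)].
Qed.

Lemma unitary_comm s t f : in_L2 Om f -> eq_ae (U s (U t f)) (U t (U s f)).
Proof.
move=> Lf; apply: eq_ae_trans (eq_ae_sym (ugrp_add grpU s t Lf)) _.
by rewrite addrC; exact: (ugrp_add grpU).
Qed.

(** The function [U s f - f - s * two_pi_i * g], written as a nested linear
    combination so that the linearity lemmas for [U] and for [W] apply as they
    stand. *)
Definition first_order_defect s f g : R -> R[i] :=
  fun x => -1 * f x + (- (two_pi_i * s%:C) * g x + U s f x).

Lemma in_L2_defect s f g : in_L2 Om f -> in_L2 Om g ->
  in_L2 Om (first_order_defect s f g).
Proof.
by move=> Lf Lg; do 2 apply: in_L2_lin => //; exact: (ugrp_L2 grpU).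
Qed.

(** The operators of the group commute and preserve norms, so the error made
    over a step of length [s] is the same wherever on the orbit the step starts. *)
Lemma defect_unitary s t f g : in_L2 Om f -> in_L2 Om g ->
  sqnorm (first_order_defect s (U t f) (U t g)) =
  sqnorm (first_order_defect s f g).
Proof.
move=> Lf Lg; have LU := ugrp_L2 grpU.
rewrite -[RHS](unitary_sqnorm t); last exact: in_L2_defect.
apply: sqnorm_eq_ae.
- by have [] := in_L2_defect s (LU t f Lf) (LU t g Lg).
- by have [] := LU t _ (in_L2_defect s Lf Lg).
- apply: eq_ae_sym; apply: eq_ae_trans (unitary_lin2 t _ _ Lf Lg (LU s f Lf)) _.
  apply: eq_ae_lin; first exact: aeW.
  by apply: eq_ae_lin; [exact: aeW|exact: unitary_comm].
Qed.

(** Translates the convergence of difference quotients, which defines the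
    generator, into smallness of the defect relative to [s]. *)
Lemma diff_quotient_defect (s : R) f g : in_L2 Om f -> in_L2 Om g -> s != 0 ->
  sqnorm (fun x => (s^-1)%:C * (U s f x - f x) - two_pi_i * g x) =
  ((s^-1 ^+ 2)%:E * sqnorm (first_order_defect s f g))%E.
Proof.
move=> Lf Lg s0; have [mD _ _] := in_L2_defect s Lf Lg.
rewrite -sqnormc_real -sqnormZ//; congr sqnorm; apply/funext => x.
have ss : (s^-1)%:C * s%:C = 1 :> R[i] by rewrite -rmorphM mulVf.
rewrite /first_order_defect; move: two_pi_i (U s f x) (f x) (g x) => p u y z.
have -> : (s^-1)%:C * (-1 * y + (- (p * s%:C) * z + u)) =
    (s^-1)%:C * (u - y) - ((s^-1)%:C * s%:C) * (p * z) by ring.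
by rewrite ss mul1r.
Qed.

(** The domain of the generator is invariant under the group: the difference
    quotients at [U t f] are as close to their limit as those at [f]. *)
Lemma generator_unitary H t f g : is_exp_group Om H U -> H f g ->
  H (U t f) (U t g).
Proof.
move=> [_ genU] /genU[Lf Lg cvfg].
have LU := ugrp_L2 grpU; apply/genU; split; [exact: LU|exact: LU|].
apply: cvg_trans cvfg; apply: near_eq_cvg; near=> s.
have s0 : s != 0 by near: s; exact: nbhs_dnbhs_neq.
by rewrite !diff_quotient_defect//; [rewrite defect_unitary|exact: LU|exact: LU].
Unshelve. all: by end_near. Qed.

End Unitary.
End L2_facts.

(** * The evolution in the spectral representation *)

Lemma sume_const {R : realType} (K : nat) (x : \bar R) :
  (\sum_(0 <= j < K) x = K%:R%:E * x)%E.
Proof.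
elim: K => [|K ih]; first by rewrite big_geq// mul0e.
rewrite big_nat_recr//= ih -natr1 EFinD ge0_muleDl ?lee_fin ?ler0n//.
by rewrite mul1e.
Qed.

Definition window {R : realType} (M : R) : set R := `[- M, M]%classic.

Section Evolution.
Context {R : realType}.
Variables (Om : set R) (H : (R -> R[i]) -> (R -> R[i]) -> Prop).
Variables (U : R -> (R -> R[i]) -> R -> R[i]).
Variables (mu : {measure set (measurableTypeR R) -> \bar R}).
Variables (m : R -> option nat) (W : (R -> R[i]) -> R -> nat -> R[i]).
Hypotheses (mult_m : multiplicity_function m) (isoW : isometric_iso mu m Om W).
Implicit Types (f g h : R -> R[i]) (a b : R[i]) (lam : R).

Lemma eq_mu_trans (u v w : R -> nat -> R[i]) :
  eq_mu mu u v -> eq_mu mu v w -> eq_mu mu u w.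
Proof.
by move=> uv vw; apply: (ae_sub (ae_and uv vw)) => lam [h1 h2] n; rewrite h1 h2.
Qed.

Lemma eq_mu_lin a (u u' v v' : R -> nat -> R[i]) :
  eq_mu mu u u' -> eq_mu mu v v' ->
  eq_mu mu (fun lam n => a * u lam n + v lam n) (fun lam n => a * u' lam n + v' lam n).
Proof.
by move=> uv vw; apply: (ae_sub (ae_and uv vw)) => lam [h1 h2] n; rewrite h1 h2.
Qed.

Lemma measurable_section_iso f : in_L2 Om f -> measurable_section m (W f).
Proof.
move=> Lf; have [mW _ _] := iso_L2 isoW Lf.
by move=> n; have [h1 h2] := mW n; split; exact: measurable_funTS.
Qed.

Lemma energy_iso f : in_L2 Om f -> energy mu m setT (W f) = sqnorm f.
Proof. exact: (iso_norm isoW). Qed.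

Lemma iso_lin2 a b f g h : in_L2 Om f -> in_L2 Om g -> in_L2 Om h ->
  eq_mu mu (W (fun x => a * f x + (b * g x + h x)))
    (fun lam n => a * W f lam n + (b * W g lam n + W h lam n)).
Proof.
move=> Lf Lg Lh; apply: eq_mu_trans (iso_linear isoW a Lf (in_L2_lin b Lg Lh)) _.
by apply: eq_mu_lin; [exact: aeW|exact: (iso_linear isoW)].
Qed.

Lemma in_L2_0 : in_L2 Om (fun=> 0).
Proof.
split=> //.
by rewrite /sqnorm integral0_eq// => x _; rewrite sqnormc0.
Qed.

(** Finite linear combinations only: the infinite sum given by the boundary
    matrix is reached afterwards by isometry, not by continuity of [W]. *)
Lemma iso_sum (J : Type) (r : seq J) (c : J -> R[i]) (v : J -> R -> R[i]) :
  (forall j, in_L2 Om (v j)) ->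
  in_L2 Om (fun x => \sum_(j <- r) c j * v j x) /\
  eq_mu mu (W (fun x => \sum_(j <- r) c j * v j x))
    (fun lam n => \sum_(j <- r) c j * W (v j) lam n).
Proof.
move=> Lv; elim: r => [|j r [Lr ih]].
  rewrite (_ : (fun _ => _) = fun=> 0); last by apply/funext => x; rewrite big_nil.
  split; first exact: in_L2_0.
  have /ae_sub := iso_linear isoW (-1) in_L2_0 in_L2_0; apply => lam h n.
  rewrite big_nil; have := h n; rewrite (_ : (fun _ => _) = fun=> 0).
    by rewrite mulN1r addNr.
  by apply/funext => x; rewrite mulr0 addr0.
rewrite (_ : (fun x => _) = fun x => c j * v j x + \sum_(i <- r) c i * v i x); last first.
  by apply/funext => x; rewrite big_cons.
split; first exact: in_L2_lin.
apply: eq_mu_trans (iso_linear isoW (c j) (Lv j) Lr) _.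
apply: eq_mu_trans (eq_mu_lin _ (aeW _ _) ih) _ => //.
by apply: aeW => lam n; rewrite big_cons.
Qed.

Hypotheses (expU : is_exp_group Om H U).
Hypothesis (HW : forall f g, H f g ->
  eq_mu mu (W g) (fun lam n => lam%:C * W f lam n)).

Let grpU : unitary_group Om U := expU.1.

(** The defect read in the spectral representation, where the generator is the
    multiplication by [two_pi_i * lam]. *)
Lemma defect_iso s t f g : H f g ->
  energy mu m setT (fun lam n =>
    W (U (s + t) f) lam n - (1 + two_pi_i * (s * lam)%:C) * W (U t f) lam n)
  = sqnorm (first_order_defect U s f g).
Proof.
move=> Hfg; have [Lf Lg _] := (expU.2 f g).1 Hfg.
have LU := ugrp_L2 grpU.
have LUt := LU t f Lf; have LUg := LU t g Lg; have LUst := LU s _ LUt.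
rewrite -(defect_unitary grpU s t Lf Lg) -energy_iso; last exact: in_L2_defect.
have mU := measurable_section_iso LUt.
have mUst := measurable_section_iso (LU (s + t) f Lf).
apply: energy_ae_eq => //.
- move=> n.
  apply: cmeasurableB => //; apply: cmeasurableM => //.
  apply: cmeasurableD => //.
  by apply: cmeasurableM => //; exact: cmeasurable_scale.
- by apply: measurable_section_iso; exact: in_L2_defect.
- have e1 := iso_lin2 (-1) (- (two_pi_i * s%:C)) LUt LUg LUst.
  have e2 := HW (generator_unitary grpU t expU Hfg).
  have e3 := iso_eq_ae isoW (LU (s + t) f Lf) LUst (ugrp_add grpU s t Lf).
  apply: (ae_sub (ae_and e1 (ae_and e2 e3))) => lam [h1 [h2 h3]] _ n _.
  rewrite [RHS]h1 h2 -h3 rmorphM; ring.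
Qed.

(** With [w j := W (U (j * s) f)], the difference to be estimated telescopes:
    setting [p j := expi (lam * (K - j) * s) * w j], it is [p K - p 0], and each
    increment is, up to a phase, the defect of step [j] minus the Taylor remainder
    of [expi (lam * s)] applied to [w j]. *)
Lemma iso_evolution_bound (M t s Q : R) (K : nat) f g : H f g ->
  `|s| <= 1 -> t = K%:R * s ->
  Q = (2 * pi * M) ^+ 4 + (2 * pi * M) ^+ 6 ->
  (energy mu m (window M) (fun lam n =>
     (W (U t f) lam n - expi (lam * t) * W (U 0 f) lam n)%R)
   <= (2 * K%:R ^+ 2)%:E *
      (sqnorm (first_order_defect U s f g) + (s ^+ 4 * Q)%:E * sqnorm f))%E.
Proof.
move=> Hfg s1 tKs QE; have [Lf Lg _] := (expU.2 f g).1 Hfg.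
have LU := ugrp_L2 grpU.
pose w j := W (U (j%:R * s) f).
have mw j : measurable_section m (w j) by apply: measurable_section_iso; exact: LU.
pose p j lam n := expi (lam * ((K%:R - j%:R) * s)) * w j lam n.
have mA : measurable (window M) by exact: measurable_itv.
have mp j : measurable_section m (p j).
  move=> n.
  apply: cmeasurableM; [exact: cmeasurable_expi|exact: mw].
have mBp j : measurable_section m (fun lam n => p j.+1 lam n - p j lam n).
  by move=> n; apply: cmeasurableB; [exact: mp|exact: mp].
pose c1 lam := expi (lam * s) - 1 - two_pi_i * (s * lam)%:C.
have mc1 n : cmeasurable [set lam | below n (m lam)] c1.
  apply: cmeasurableB => //.
    apply: cmeasurableB => //.
    exact: cmeasurable_expi.
  by apply: cmeasurableM => //; exact: cmeasurable_scale.
pose v0 j lam n := w j.+1 lam n - (1 + two_pi_i * (s * lam)%:C) * w j lam n.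
pose v1 j lam n := c1 lam * w j lam n.
have mv1 j : measurable_section m (v1 j).
  by move=> n; apply: cmeasurableM; [exact: mc1|exact: mw].
have mv0 j : measurable_section m (v0 j).
  move=> n; apply: cmeasurableB; first exact: mw.
  apply: cmeasurableM; last exact: mw.
  apply: cmeasurableD => //.
  by apply: cmeasurableM => //; exact: cmeasurable_scale.
have Q0 : 0 <= Q.
  by rewrite QE (exprM _ 2 2) (exprM _ 2 3) addr_ge0// exprn_ge0// sqr_ge0.
have sQ0 : 0 <= s ^+ 4 * Q.
  by rewrite mulr_ge0// (exprM _ 2 2) sqr_ge0.
(* The assumption on s absorbs the term in s^6 of the Taylor remainder. *)
have c1Q lam : window M lam -> sqnormc (c1 lam) <= s ^+ 4 * Q.
  rewrite /window /= in_itv/= => /andP[lM1 lM2].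
  rewrite /c1 [s * lam]mulrC; apply: (le_trans (sqnormc_expi_taylor _)).
  pose a := (2 * pi * lam) ^+ 2; pose b := (2 * pi * M) ^+ 2.
  have pi0 := pi_ge0 R.
  have ab : a <= b.
    rewrite /a /b -[X in X <= _]ger0_norm ?sqr_ge0// normrX.
    rewrite lerXn2r ?nnegrE ?normr_ge0//.
      by rewrite !mulr_ge0//; lra.
    by rewrite normrM (ger0_norm (x := 2 * pi)) ?mulr_ge0// ler_wpM2l ?mulr_ge0// ler_norml lM1.
  have a0 : 0 <= a by exact: sqr_ge0.
  have s2 : s ^+ 2 <= 1.
    by rewrite -[X in X <= _]ger0_norm ?sqr_ge0// normrX expr_le1.
  have s20 : 0 <= s ^+ 2 by exact: sqr_ge0.
  have -> : (2 * pi * (lam * s)) ^+ 4 = (s ^+ 2) ^+ 2 * a ^+ 2 by rewrite /a; ring.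
  have -> : (2 * pi * (lam * s)) ^+ 6 = (s ^+ 2) ^+ 3 * a ^+ 3 by rewrite /a; ring.
  have -> : s ^+ 4 * Q = (s ^+ 2) ^+ 2 * b ^+ 2 + (s ^+ 2) ^+ 2 * b ^+ 3.
    by rewrite QE /b; ring.
  rewrite lerD//; first by rewrite ler_wpM2l ?sqr_ge0// lerXn2r ?nnegrE// (le_trans a0).
  have s3 : (s ^+ 2) ^+ 3 <= (s ^+ 2) ^+ 2.
    by rewrite [_ ^+ 3]exprSr ler_piMr// exprn_ge0.
  have ab3 : a ^+ 3 <= b ^+ 3 by rewrite lerXn2r ?nnegrE// (le_trans a0).
  by rewrite ler_pM// exprn_ge0.
have ev0 j : (energy mu m (window M) (v0 j) <= sqnorm (first_order_defect U s f g))%E.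
  rewrite -(defect_iso s (j%:R * s) Hfg).
  have -> : s + j%:R * s = j.+1%:R * s by rewrite -natr1 mulrDl mul1r addrC.
  by apply: energy_subset => //; exact: mv0.
have ev1 j : (energy mu m (window M) (v1 j) <= (s ^+ 4 * Q)%:E * sqnorm f)%E.
  rewrite -(unitary_sqnorm grpU (j%:R * s) Lf) -energy_iso//; last exact: LU.
  apply: (@le_trans _ _ ((s ^+ 4 * Q)%:E * energy mu m (window M) (w j))%E); last first.
    by rewrite lee_wpmul2l ?lee_fin ?sQ0//; apply: energy_subset.
  have := @energy_dominate _ mu m mult_m (window M) (s ^+ 4 * Q) 1
    (fun=> w j) (v1 j) mA.
  rewrite big_nat1; apply => //.
  move=> lam n lamM bn; rewrite big_nat1 sqnormcM ler_wpM2r ?sqnormc_ge0//.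
  exact: c1Q.
have eBp j : (energy mu m (window M) (fun lam n => (p j.+1 lam n - p j lam n)%R) <=
    2%:E * (sqnorm (first_order_defect U s f g) + (s ^+ 4 * Q)%:E * sqnorm f))%E.
  have := @energy_dominate _ mu m mult_m (window M) 2 2
    (fun i => if i == 0%N then v0 j else v1 j) _ mA _ (mBp j).
  rewrite big_nat_recr//= big_nat1/= => h.
  apply: (@le_trans _ _ (2%:E *
      (energy mu m (window M) (v0 j) + energy mu m (window M) (v1 j)))%E); last first.
    by rewrite lee_wpmul2l//; apply: leeD; [exact: ev0|exact: ev1].
  apply: h => //; first by move=> i; case: ifP.
  move=> lam n _ _; rewrite big_nat_recr//= big_nat1/=.
  have -> : p j.+1 lam n - p j lam n =
      expi (lam * ((K%:R - j.+1%:R) * s)) * (v0 j lam n + - v1 j lam n).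
    rewrite /p /v0 /v1 /c1.
    have -> : lam * ((K%:R - j%:R) * s) = lam * ((K%:R - j.+1%:R) * s) + lam * s.
      by rewrite -natr1; ring.
    by rewrite expiD; ring.
  by rewrite sqnormcM sqnormc_expi mul1r -(sqnormcN (v1 j lam n)) sqnormcD.
have -> : energy mu m (window M) (fun lam n =>
     W (U t f) lam n - expi (lam * t) * W (U 0 f) lam n) =
   energy mu m (window M) (fun lam n => (p K lam n - p 0%N lam n)%R).
  congr energy; apply/funext => lam; apply/funext => n; rewrite /p /w.
  by rewrite subrr subr0 !mul0r mulr0 expi0 mul1r -tKs.
apply: (@le_trans _ _ (K%:R%:E * \sum_(0 <= j < K)
    energy mu m (window M) (fun lam n => (p j.+1 lam n - p j lam n)%R))%E).
  apply: energy_dominate => //.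
    by move=> n; apply: cmeasurableB; [exact: mp|exact: mp].
  move=> lam n _ _; have := sqnormc_sum K (fun j => p j.+1 lam n - p j lam n).
  by rewrite (telescope_sumr (fun j => p j lam n)).
apply: (@le_trans _ _ (K%:R%:E * \sum_(0 <= j < K)
   (2%:E * (sqnorm (first_order_defect U s f g) + (s ^+ 4 * Q)%:E * sqnorm f)))%E).
  by rewrite lee_wpmul2l//; apply: lee_sum => j _; exact: eBp.
rewrite sume_const; move: (_ + _)%E => X; rewrite !muleA -!EFinM.
by rewrite (_ : _ * 2 = 2 * K%:R ^+ 2) //; ring.
Qed.

(** Since [K * s = t] is fixed, the bound is [2 * t ^+ 2] times
    s^-2 (defect + s^4 Q |f|^2), which tends to 0 with [s]; hence the difference
    vanishes on every window. *)
Lemma iso_evolution t f g : t != 0 -> H f g ->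
  eq_mu mu (W (U t f)) (fun lam n => expi (lam * t) * W f lam n).
Proof.
move=> t0 Hfg; have [Lf Lg cvf] := (expU.2 f g).1 Hfg.
have LU := ugrp_L2 grpU.
have mw s : measurable_section m (W (U s f)).
  by apply: measurable_section_iso; exact: LU.
pose d lam n := W (U t f) lam n - expi (lam * t) * W (U 0 f) lam n.
have md : measurable_section m d.
  move=> n; apply: cmeasurableB; first exact: mw.
  by apply: cmeasurableM; [exact: cmeasurable_expi|exact: mw].
have d0 M : energy mu m (window M) d = 0%E.
  apply/eqP; rewrite eq_le energy_ge0 andbT.
  apply/lee_addgt0Pr => e e0; rewrite add0e.
  pose Q := (2 * pi * M) ^+ 4 + (2 * pi * M) ^+ 6.
  pose nu := fine (sqnorm f).
  have nuE : sqnorm f = nu%:E.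
    by rewrite fineK// ge0_fin_numE ?sqnorm_ge0//; case: Lf.
  have Qnu0 : 0 <= Q * nu.
    rewrite mulr_ge0 ?fine_ge0 ?sqnorm_ge0// /Q (exprM _ 2 2) (exprM _ 2 3).
    by rewrite addr_ge0// exprn_ge0// sqr_ge0.
  have t2 : 0 < t ^+ 2 by rewrite exprn_even_gt0.
  (* The bound 2 K^2 (D + s^4 Q nu) has two terms; each is made at most
     2 K^2 s^2 eta = 2 t^2 eta = e / 2. *)
  pose eta := e / (4 * t ^+ 2).
  have eta0 : 0 < eta by rewrite divr_gt0// mulr_gt0.
  pose rho := Num.min 1 (eta / (Q * nu + 1)).
  have rho0 : 0 < rho by rewrite lt_min ltr01/= divr_gt0// ltr_wpDl.
  pose q (s x : R) := (s^-1)%:C * (U s f x - f x) - two_pi_i * g x.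
  have nb : nbhs (0%E : \bar R) [set y | (y < eta%:E)%E].
    apply: open_nbhs_nbhs.
    by split; [exact: open_ereal_lt_ereal|rewrite /= lte_fin].
  have near_s : \forall s \near (0 : R)^', `|s| <= rho /\
      (sqnorm (q s) < eta%:E)%E.
    near=> s; split; first by near: s; exact: dnbhs0_le.
    by near: s; exact: cvf _ nb.
  have cvs : t / n.+1%:R @[n --> \oo] --> (0 : R).
    by rewrite -[X in _ --> X](mulr0 t); apply: cvgMr; exact: cvg_harmonic.
  have [n _ /(_ n (leqnn n)) ns] := cvs _ near_s.
  have s0 : t / n.+1%:R != 0 by rewrite mulf_neq0// invr_eq0 pnatr_eq0.
  have {ns} := ns s0; set s := t / n.+1%:R => -[srho].
  rewrite /q (diff_quotient_defect grpU)// => defs.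
  have tE : t = n.+1%:R * s by rewrite /s mulrC divfK// pnatr_eq0.
  have s1 : `|s| <= 1 by rewrite (le_trans srho)// ge_min lexx.
  apply: (le_trans (iso_evolution_bound Hfg s1 tE (erefl Q))).
  have LD : in_L2 Om (first_order_defect U s f g) by exact: in_L2_defect.
  have fD : sqnorm (first_order_defect U s f g) \is a fin_num.
    by rewrite ge0_fin_numE ?sqnorm_ge0//; case: LD.
  pose D := fine (sqnorm (first_order_defect U s f g)).
  have DE : sqnorm (first_order_defect U s f g) = D%:E by rewrite fineK.
  move: defs; rewrite nuE DE -EFinM lte_fin => defs.
  rewrite -(EFinM (s ^+ 4 * Q) nu) -(EFinD D) -EFinM lee_fin.
  have s2 : 0 < s ^+ 2 by rewrite exprn_even_gt0.
  have De : D <= s ^+ 2 * eta.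
    by rewrite mulrC -ler_pdivrMr// ltW// mulrC -exprVn.
  have sQ : s ^+ 2 * (Q * nu) <= eta.
    have : `|s| <= eta / (Q * nu + 1) by rewrite (le_trans srho)// ge_min lexx orbT.
    rewrite ler_pdivlMr; last by rewrite ltr_wpDl.
    apply: le_trans.
    rewrite -[s ^+ 2]real_normK ?num_real// expr2 -mulrA ler_wpM2l//.
    by rewrite (le_trans _ (_ : Q * nu <= _)) ?ler_piMl// lerDl.
  have sQ4 : s ^+ 4 * Q * nu <= s ^+ 2 * eta.
    have -> : s ^+ 4 * Q * nu = s ^+ 2 * (s ^+ 2 * (Q * nu)) by ring.
    by rewrite ler_pM2l.
  apply: (@le_trans _ _ (2 * n.+1%:R ^+ 2 * (2 * (s ^+ 2 * eta)))).
    by rewrite ler_wpM2l ?mulr_ge0 ?sqr_ge0//; lra.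
  have -> : 2 * n.+1%:R ^+ 2 * (2 * (s ^+ 2 * eta)) = 4 * (n.+1%:R * s) ^+ 2 * eta by ring.
  by rewrite -tE /eta mulrC divfK// gt_eqF// mulr_gt0.
have dwin k : {ae mu, forall lam, window k%:R lam ->
    forall n, below n (m lam) -> d lam n = 0}.
  by apply: (energy_eq0 mult_m) => //; exact: measurable_itv.
have W0 := iso_eq_ae isoW (LU 0 f Lf) Lf (ugrp_zero grpU Lf).
have [_ zf _] := iso_L2 isoW Lf; have [_ zt _] := iso_L2 isoW (LU t f Lf).
apply: (ae_sub (ae_and W0 (ae_foralln dwin))) => lam [h1 h2] n.
have [bn|bn] := boolP (below n (m lam)); last first.
  by rewrite zf// zt// mulr0.
apply/eqP; rewrite -subr_eq0 -h1; apply/eqP.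
have lamw : window (Num.truncn `|lam|).+1%:R lam.
  rewrite /window/= in_itv/= -ler_norml; apply: ltW.
  by rewrite truncnS_gt.
exact: (h2 _ lamw).
Unshelve. all: by end_near. Qed.
End Evolution.

(** * From convergence in the direct integral to pointwise sums *)

Section Exhaustion.
Local Open Scope fset_scope.

(** Reduces nets indexed by finite subsets of a countable type to sequences,
    which the integration theory can handle. *)
Lemma totally_exhaustion (K : countType) :
  exists E : nat -> {fset K}, E @ \oo --> totally.
Proof.
exists (fun j => [fset x | x in pmap choice.unpickle (iota 0 j)]).
move=> P [A _ AP].
exists (\max_(x : A) (choice.pickle (val x)).+1)%N => // j /= Nj; apply: AP => /=.
apply/fsubsetP => x xA; rewrite !inE /= mem_pmap.
apply/mapP; exists (choice.pickle x); last by rewrite choice.pickleK.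
rewrite mem_iota /= add0n; apply: leq_trans Nj.
exact: (leq_bigmax [` xA]).
Qed.

End Exhaustion.

Section Clauses.
Context {R : realType}.
Variables (mu : {measure set (measurableTypeR R) -> \bar R}).
Variables (m : R -> option nat) (mult_m : multiplicity_function m).

(** Norm convergence gives no pointwise convergence, but the infimum of the
    tail of the fibre norms has integral 0. This is enough, and avoids the
    extraction of a subsequence. *)
Lemma energy_cvg0_ae (A : set R) (v : nat -> R -> nat -> R[i]) :
  measurable A -> (forall j, measurable_section m (v j)) ->
  energy mu m A (v j) @[j --> \oo] --> 0%E ->
  {ae mu, forall lam, A lam -> forall (N : nat) (e : R), 0 < e ->
    exists2 j, (N <= j)%N &
      forall n, below n (m lam) -> sqnormc (v j lam n) < e}.
Proof.
move=> mA mv cv0; pose f j lam := fiber_sqnorm m (v j) lam.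
have mf j : measurable_fun A (f j).
  by apply: measurable_funTS; exact: measurable_fiber_sqnorm.
have f0 j lam : (0 <= f j lam)%E by exact: fiber_sqnorm_ge0.
have e0 N lam : (0 <= einfs (f ^~ lam) N)%E.
  by apply: le_ereal_inf_tmp => _ [j /= _ <-].
have mef N : measurable_fun A (fun lam => einfs (f ^~ lam) N).
  exact: measurable_fun_einfs.
have int0 N : (\int[mu]_(lam in A) einfs (f ^~ lam) N = 0)%E.
  apply/eqP; rewrite eq_le integral_ge0 ?andbT//.
  apply: (cvge_ge _ cv0).
  exists N => // j /= Nj; apply: ge0_le_integral => //.
  - exact: mef.
  - exact: mf.
  - by move=> lam _; apply: ereal_inf_lbound; exists j.
have ae0 : {ae mu, forall lam, forall N, A lam -> einfs (f ^~ lam) N = 0%E}.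
  apply: ae_foralln => N.
  have : (\int[mu]_(lam in A) `|einfs (f ^~ lam) N| = 0)%E.
    rewrite -[RHS](int0 N); apply: eq_integral => lam _.
    by rewrite gee0_abs.
  by move=> /(ae_eq_integral_abs mu mA (mef N)) h; apply: (ae_sub h).
apply: (ae_sub ae0) => lam h Alam N e epos.
apply: contrapT => noj.
have : (e%:E <= einfs (f ^~ lam) N)%E.
  apply: le_ereal_inf_tmp => _ [j /= Nj <-].
  rewrite leNgt; apply/negP => fe; apply: noj; exists j => // n bn.
  by rewrite -lte_fin; apply: le_lt_trans fe; exact: sqnormc_le_fiber.
by rewrite h// lee_fin leNgt epos.
Qed.

(** Along the exhaustion the partial sums come back arbitrarily close to
    [c lam n] at arbitrarily late stages, while they converge to [s]. The null set
    is chosen before [n] and [s]. *)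
Lemma limit_ae_unique (K : countType) (A : set R)
    (u : R -> nat -> K -> R[i]) (c : R -> nat -> R[i]) :
  measurable A ->
  (forall F, measurable_section m (fun lam n => partial_sum (u lam n) F - c lam n)) ->
  energy mu m A (fun lam n => partial_sum (u lam n) F - c lam n)
    @[F --> totally] --> 0%E ->
  {ae mu, forall lam, A lam -> forall n s, below n (m lam) ->
    has_sum (u lam n) s -> s = c lam n}.
Proof.
move=> mA mv cv0; have [E cvE] := totally_exhaustion K.
have cvE0 := cvg_comp _ _ cvE cv0.
have h := energy_cvg0_ae mA (fun j => mv (E j)) cvE0.
apply: (ae_sub h) => lam {}h Alam n s bn sums.
apply/eqP; rewrite -subr_eq0; apply/eqP; apply: sqnormc_eq0.
apply/eqP; rewrite eq_le sqnormc_ge0 andbT; apply/ler_addgt0Pr => e e0.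
rewrite add0r; have e4 : 0 < e / 4 by rewrite divr_gt0.
have near_e : \forall F \near totally, sqnormc (partial_sum (u lam n) F - s) < e / 4.
  have FF : Filter (@totally K) by case: (@totally_filter K).
  exact: (cvgr_lt _ sums).
have [N _ EN] := cvE _ near_e.
have [j Nj /(_ n bn) uj] := h Alam N _ e4.
have ps : sqnormc (partial_sum (u lam n) (E j) - s) < e / 4 := EN j Nj.
move: uj ps; set p := partial_sum _ _ => pc ps.
have -> : s - c lam n = (p - c lam n) + - (p - s) by ring.
by have := sqnormcD (p - c lam n) (- (p - s)); rewrite sqnormcN; lra.
Qed.

End Clauses.

(** * Bumps inside a component *)

Section Component_bumps.
Context {R : realType} {I : countType}.
Variables (alpha beta : I -> \bar R).
Hypotheses (alpha_lt_beta : forall i, (alpha i < beta i)%E)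
  (disjoint_components : trivIset setT (component alpha beta)).
Local Notation Om := (Omega alpha beta).

Lemma left_endE (i : fin_left alpha) : alpha (val i) = (left_end i)%:E.
Proof.
rewrite /left_end fineK//; have := valP i; have := alpha_lt_beta (val i).
by case: (alpha (val i)) => //; case: (beta (val i)).
Qed.

Lemma right_endE (k : fin_right beta) : beta (val k) = (right_end k)%:E.
Proof.
rewrite /right_end fineK//; have := valP k; have := alpha_lt_beta (val k).
by case: (beta (val k)) => //; case: (alpha (val k)).
Qed.

Lemma lt_min_length (e : R) i : (e%:E < min_length alpha beta)%E ->
  (e%:E < beta i - alpha i)%E.
Proof.
by move=> h; apply: (lt_le_trans h); apply: ereal_inf_lbound; exists i.
Qed.

(** A strip narrower than the minimal length fits in the component, also when
    the component is unbounded. *)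
Lemma left_strip (e c : R) (i : fin_left alpha) :
  (e%:E < min_length alpha beta)%E ->
  left_end i < c < left_end i + e -> component alpha beta (val i) c.
Proof.
move=> /(lt_min_length (val i)); rewrite /component/= left_endE => h /andP[c1 c2].
split; first by rewrite lte_fin.
move: h; case: (beta _) => [b| |] h; [|by rewrite ltry|by []].
by move: h; rewrite -EFinB !lte_fin; lra.
Qed.

Lemma right_strip (e c : R) (k : fin_right beta) :
  (e%:E < min_length alpha beta)%E ->
  right_end k - e < c < right_end k -> component alpha beta (val k) c.
Proof.
move=> /(lt_min_length (val k)); rewrite /component/= right_endE => h /andP[c1 c2].
split; last by rewrite lte_fin.
move: h; case: (alpha _) => [b| |] h; [|by []|by rewrite ltNyr].
by move: h; rewrite -EFinB !lte_fin; lra.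
Qed.

Lemma test_function_bump (i : I) (c d : R) :
  (forall x, c - d <= x <= c + d -> component alpha beta i x) ->
  test_function Om (fun x => (bump c d x)%:C).
Proof.
move=> cd; split; first exact: csmooth_bump.
exists `[c - d, c + d]%classic; split.
- exact: segment_compact.
- by move=> x; rewrite /= in_itv/= => /cd; exists i.
- move=> x; rewrite /= in_itv/= => /negP xcd; rewrite bump_out// => /andP[h1 h2].
  by move/negP: xcd; apply; rewrite !ltW.
Qed.

(** Disjointness leaves a single nonzero term in the sum over the components,
    and the transform of the bump splits into a phase that carries its centre and
    a factor that does not depend on it. *)
Lemma F_C_bump (m : R -> option nat) (C : R -> nat -> I -> R[i]) (i : I) (c d lam : R) n :
  (forall x, c - d <= x <= c + d -> component alpha beta i x) ->
  below n (m lam) ->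
  F_C m alpha beta C (fun x => (bump c d x)%:C) lam n =
  C lam n i * (expi (- (lam * c)) * fourier (fun x => (bump 0 d x)%:C) lam).
Proof.
move=> cd bn; rewrite /F_C bn -fourier_bump.
have comp x : bump c d x != 0 -> component alpha beta i x.
  apply: contra_neqP => xi; apply: bump_out => /andP[h1 h2].
  by apply: xi; apply: cd; rewrite !ltW.
rewrite -(@fsbig_widen _ _ _ _ [set i])//=; last first.
  move=> j [_ /= ji]; rewrite (_ : Defs.cut _ _ _ j = fun=> 0); last first.
    apply/funext => x; rewrite /Defs.cut; case: ifPn => //; rewrite inE => xj.
    apply/eqP; apply: contra_notT ji => bx.
    have {}bx : bump c d x != 0 by apply: contra_neq bx => ->.
    by apply: (disjoint_components Logic.I Logic.I); exists x; split => //; exact: comp.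
  rewrite (_ : fourier _ lam = 0) ?mulr0// /fourier /cintegral.
  by rewrite /Rintegral !integral0_eq// => x _; rewrite mul0r.
rewrite fsbig_set1; congr (_ * fourier _ _); apply/funext => x.
rewrite /Defs.cut; case: ifPn => // /negP; rewrite inE => xi.
by have [->|/comp//] := eqVneq (bump c d x) 0.
Qed.

End Component_bumps.

(** * The boundary relation *)

Section Boundary_relation.
Context {R : realType} {I : countType}.
Variables (alpha beta : I -> \bar R)
  (H : (R -> R[i]) -> (R -> R[i]) -> Prop) (U : R -> (R -> R[i]) -> R -> R[i])
  (mu : {measure set (measurableTypeR R) -> \bar R}) (m : R -> option nat)
  (C : R -> nat -> I -> R[i]) (B : fin_left alpha -> fin_right beta -> R[i])
  (W : (R -> R[i]) -> R -> nat -> R[i]).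
Local Notation Om := (Omega alpha beta).
Hypotheses (alpha_lt_beta : forall i, (alpha i < beta i)%E)
  (disjoint_components : trivIset setT (component alpha beta))
  (min_length_gt0 : (0 < min_length alpha beta)%E)
  (linH : linear_operator Om H) (extH : extends_D Om H)
  (expU : is_exp_group Om H U) (bdryB : boundary_matrix U B)
  (mult_m : multiplicity_function m) (mC : measurable_field m C)
  (isoW : isometric_iso mu m Om W)
  (WF : forall phi, test_function Om phi ->
     eq_mu mu (W phi) (F_C m alpha beta C phi))
  (HW : forall f g, H f g -> eq_mu mu (W g) (fun lam n => lam%:C * W f lam n)).

Lemma ae_forall_count (K : countType) (P : K -> R -> Prop) :
  (forall k, {ae mu, forall lam, P k lam}) ->
  {ae mu, forall lam, forall k, P k lam}.
Proof.
move=> aeP.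
have aeQ : {ae mu, forall lam, forall j : nat,
    if choice.unpickle j is Some k then P k lam else True}.
  by apply: ae_foralln => j; case: (choice.unpickle j) => [k|]; [exact: aeP|exact: aeW].
by apply: (ae_sub aeQ) => lam h k; have := h (choice.pickle k); rewrite choice.pickleK.
Qed.

Lemma exists_strip_width : exists2 e : R, 0 < e & (e%:E < min_length alpha beta)%E.
Proof.
move: min_length_gt0; case: (min_length alpha beta) => [l||//].
  by rewrite lte_fin => l0; exists (l / 2); rewrite ?lte_fin; lra.
by move=> _; exists 1; rewrite ?ltry.
Qed.

Definition defect_column (i : fin_left alpha) (F : {fset fin_right beta})
    (lam : R) (n : nat) : R[i] :=
  partial_sum (fun k => C_fbeta C lam n k * ExpBTExp B lam k i) F
    - C_falpha C lam n i.

Lemma measurable_defect_column i F : measurable_section m (defect_column i F).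
Proof.
move=> n; apply: cmeasurableB; last exact: mC.
apply: cmeasurable_sum => k; apply: cmeasurableM; first exact: mC.
apply: cmeasurableM; last exact: cmeasurable_expi.
apply: cmeasurableM => //.
rewrite (_ : (fun _ => _) = fun lam => expi (lam * - right_end (val k))).
  exact: cmeasurable_expi.
by apply/funext => lam; rewrite mulrN.
Qed.

(** The central estimate: on a window, [W] of the L^2 error in the expansion
    of [U e phi] is the defect of the column times a factor bounded below. *)
Lemma defect_column_cvg0 i (M : R) : 0 <= M ->
  energy mu m (window M) (defect_column i F) @[F --> totally] --> 0%E.
Proof.
move=> M0; have [e e0 el] := exists_strip_width.
(* The first bound keeps the bump inside the strip of width e, the second one
   keeps its transform away from 0 on the window. *)
pose d := Num.min (e / 4) (4 * pi * (M + 1))^-1.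
have pi0 := @pi_gt0 R.
have d0 : 0 < d.
  by rewrite lt_min divr_gt0//= invr_gt0 mulr_gt0 ?mulr_gt0// ltr_wpDl.
have de : d < e / 2 by apply: (@le_lt_trans _ _ (e / 4)); [rewrite ge_min lexx|lra].
pose Psi := fourier (fun x : R => (bump 0 d x)%:C).
pose c0 := (expR (- (d / 2)^-1) ^+ 2 * d / 2) ^+ 2.
have c0_gt0 : 0 < c0 by rewrite exprn_gt0// divr_gt0// mulr_gt0 ?exprn_gt0 ?expR_gt0.
have Psi_ge lam : window M lam -> c0 <= sqnormc (Psi lam).
  rewrite /window/= in_itv/= -ler_norml => lamM; apply: fourier_bump_lb => //.
  have dM : d <= (4 * pi * (M + 1))^-1 by rewrite ge_min lexx orbT.
  apply: (@le_trans _ _ (2 * pi * (M + 1) * (4 * pi * (M + 1))^-1)).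
    by rewrite ler_pM ?mulr_ge0 ?(ltW pi0) ?(ltW d0)// ler_wpM2l ?mulr_ge0 ?(ltW pi0)//; lra.
  have P0 : 0 < 2 * pi * (M + 1) by rewrite mulr_gt0 ?mulr_gt0// ltr_wpDl.
  have -> : 4 * pi * (M + 1) = 2 * (2 * pi * (M + 1)) by ring.
  by rewrite invfM mulrCA divff ?mulr1 ?gt_eqF.
pose phi x : R[i] := (bump (left_end i + e / 2) d x)%:C.
pose psi (k : fin_right beta) x : R[i] := (bump (right_end k - e / 2) d x)%:C.
have in_i x : left_end i + e / 2 - d <= x <= left_end i + e / 2 + d ->
    component alpha beta (val i) x.
  by move=> /andP[x1 x2]; apply: (left_strip alpha_lt_beta el); apply/andP; split; lra.
have in_k (k : fin_right beta) x : right_end k - e / 2 - d <= x <= right_end k - e / 2 + d ->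
    component alpha beta (val k) x.
  by move=> /andP[x1 x2]; apply: (right_strip alpha_lt_beta el); apply/andP; split; lra.
have Tphi : test_function Om phi by apply: test_function_bump in_i.
have Tpsi k : test_function Om (psi k) by apply: test_function_bump (in_k k).
have Hphi := extH Tphi.
have [Lphi _] := op_L2 linH Hphi.
have Lpsi k : in_L2 Om (psi k) by have [] := op_L2 linH (extH (Tpsi k)).
have LU := ugrp_L2 expU.1 e Lphi.
have e_neq0 : e != 0 by rewrite gt_eqF.
have WU := iso_evolution mult_m isoW expU HW e_neq0 Hphi.
have Wpsi := ae_forall_count (fun k => WF (Tpsi k)).
have sphi : supported_on `[left_end i, left_end i + e]%classic phi.
  apply: aeW => x /=; rewrite in_itv/= => /negP xi.
  rewrite /phi bump_out// => /andP[x1 x2]; move/negP: xi; apply.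
  by apply/andP; split; lra.
have [_ sumU] := bdry_forward bdryB e0 el Lphi sphi.
pose g (F : {fset fin_right beta}) x := -1 * U e phi x + \sum_(k : F) B i (val k) * psi (val k) x.
have gE F : (fun x => partial_sum (fun k => B i k *
    translate (left_end i + e - right_end k) phi x) F - U e phi x) = g F.
  apply/funext => x; rewrite /g mulN1r addrC; congr (_ + _).
  apply: eq_bigr => k _; congr (_ * _%:C).
  by rewrite bump_center [RHS]bump_center; congr bump; field.
have Lsum (F : {fset fin_right beta}) := (iso_sum isoW (index_enum F) (fun k : F => B i (val k)) (fun k : F => Lpsi (val k))).1.
have Wsum (F : {fset fin_right beta}) := (iso_sum isoW (index_enum F) (fun k : F => B i (val k)) (fun k : F => Lpsi (val k))).2.
have Lg F : in_L2 Om (g F) := in_L2_lin (-1) LU (Lsum F).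
have gcvg : sqnorm (g F) @[F --> totally] --> 0%E.
  by move: sumU; rewrite /has_L2_sum; under eq_fun do rewrite gE.
have mwin : measurable (window M) by exact: measurable_itv.
have bound F : (energy mu m (window M) (defect_column i F) <= (c0^-1)%:E * sqnorm (g F))%E.
  rewrite -(energy_iso isoW (Lg F)).
  have mWg := measurable_section_iso isoW (Lg F).
  apply: (@le_trans _ _ ((c0^-1)%:E * energy mu m (window M) (W (g F)))%E); last first.
    apply: lee_wpmul2l; first by rewrite lee_fin invr_ge0 ltW.
    exact: energy_subset mwin measurableT mWg _.
  have := @ae_energy_dominate _ mu m mult_m (window M) c0^-1 1 (fun=> W (g F))
    (defect_column i F) mwin.
  rewrite big_nat1; apply => //; first by rewrite invr_ge0 ltW.
    exact: measurable_defect_column.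
  have Wlin := iso_linear isoW (-1) LU (Lsum F).
  apply: (ae_sub (ae_and Wlin (ae_and (Wsum F) (ae_and WU (ae_and (WF Tphi) Wpsi))))).
  move=> lam [h1 [h2 [h3 [h4 h5]]]] lamM n bn; rewrite big_nat1.
  (* The factor expi (lam * (e / 2 - left_end i)) is what remains of the phases
     of both sides once Exp(- lam beta) and Exp(lam alpha) are split off. *)
  have WgE : W (g F) lam n =
      expi (lam * (e / 2 - left_end i)) * Psi lam * defect_column i F lam n.
    rewrite [LHS]h1 h2 h3 h4 (F_C_bump disjoint_components C in_i bn) -/Psi.
    rewrite /defect_column /C_falpha /partial_sum mulrBr mulN1r addrC.
    congr (_ - _).
      rewrite mulr_sumr; apply: eq_bigr => k _.
      rewrite h5 (F_C_bump disjoint_components C (in_k (val k)) bn) -/Psi.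
      rewrite /C_fbeta /ExpBTExp.
      have -> : - (lam * (right_end (val k) - e / 2)) =
        lam * (e / 2 - left_end i) + - (lam * right_end (val k)) + lam * left_end i.
        by ring.
      by rewrite !expiD; ring.
    have -> : lam * (e / 2 - left_end i) = lam * e + - (lam * (left_end i + e / 2)).
      by field.
    by rewrite expiD; ring.
  rewrite WgE !sqnormcM sqnormc_expi mul1r mulrA.
  rewrite -[X in X <= _]mul1r ler_wpM2r ?sqnormc_ge0//.
  by rewrite ler_pdivlMl// mulr1 Psi_ge.
have FF : ProperFilter (@totally (fin_right beta)) := @totally_filter _.
apply: (@squeeze_cvge _ _ _ _ (fun=> 0%E) _ (fun F => (c0^-1)%:E * sqnorm (g F))%E).
- by apply: nearW => F; rewrite energy_ge0 bound.
- exact: cvg_cst.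
- by rewrite -[X in _ --> X](mule0 (c0^-1)%:E); exact: cvgeZl.
Qed.

End Boundary_relation.

Theorem theorem4p5 (R : realType) (I : countType) (alpha beta : I -> \bar R)
    (H : (R -> R[i]) -> (R -> R[i]) -> Prop)
    (U : R -> (R -> R[i]) -> R -> R[i])
    (mu : {measure set (measurableTypeR R) -> \bar R}) (m : R -> option nat)
    (C : R -> nat -> I -> R[i])
    (B : fin_left alpha -> fin_right beta -> R[i])
    (alpha_lt_beta : forall i, (alpha i < beta i)%E)
    (disjoint_components : trivIset setT (component alpha beta))
    (min_length_gt0 : (0 < min_length alpha beta)%E)
    (H_self_adjoint : self_adjoint (Omega alpha beta) H)
    (H_extends_D : extends_D (Omega alpha beta) H)
    (U_exp : is_exp_group (Omega alpha beta) H U)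
    (U_integrability : integrability_property (Omega alpha beta) U)
    (spectral : spectral_data alpha beta H mu m C)
    (boundary : boundary_matrix U B) :
  mulmx_ae mu m (C_fbeta C) (ExpBTExp B) (C_falpha C).
Proof.
have [linH _ _] := H_self_adjoint.
have [_ mult_m mC [W [isoW WF HWiff]]] := spectral.
have HW f g : H f g -> eq_mu mu (W g) (fun lam n => lam%:C * W f lam n).
  by move=> /HWiff[].
have cvg0 i M := defect_column_cvg0 alpha_lt_beta disjoint_components
  min_length_gt0 linH H_extends_D U_exp boundary mult_m mC isoW WF HW i (M := M).
have mdef i F := measurable_defect_column B mC i F.
split=> [i S cS|].
- have [M M0 SM] : exists2 M : R, 0 <= M & S `<=` window M.
    have [M0 [_ bS]] := compact_bounded cS.
    exists (`|M0| + 1); first by rewrite addr_ge0.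
    move=> x /(bS (`|M0| + 1) _) xM; rewrite /window/= in_itv/= -ler_norml.
    by apply: xM; rewrite ltr_pwDr// ler_norm.
  have mS : measurable (S : set R) by apply: closed_measurable; exact: compact_closed.
  have FF : ProperFilter (@totally (fin_right beta)) := @totally_filter _.
  apply: (@squeeze_cvge _ _ _ _ (fun=> 0%E) _
    (fun F => energy mu m (window M) (defect_column C B i F))).
  + apply: nearW => F; rewrite energy_ge0/=.
    exact: energy_subset mS (measurable_itv _) (mdef i F) SM.
  + exact: cvg_cst.
  + exact: cvg0.
- have aeik (k : nat) (i : fin_left alpha) : {ae mu, forall lam, window k%:R lam ->
      forall n s, below n (m lam) ->
      has_sum (fun k => C_fbeta C lam n k * ExpBTExp B lam k i) s ->
      s = C_falpha C lam n i}.
    by apply: limit_ae_unique => //; [exact: measurable_itv|exact: mdef|exact: cvg0].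
  have := ae_foralln (fun k => ae_forall_count (aeik k)).
  move=> h; apply: (ae_sub h) => lam {}h n i s; apply: (h (Num.truncn `|lam|).+1).
  rewrite /window/= in_itv/= -ler_norml; apply: ltW.
  by rewrite truncnS_gt.
Qed.
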